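(* Let $\phi:M^2\to N^3(c)$ be an oriented isometric immersion, let $\eta\in\mathbb C$ with $4\eta^2=c$, and let $$\mathscr B_c:=D^2+2\eta\,\omega D-2\eta H\omega+|A|^2-H^2-2c .$$ Let $\Omega\subset M$ be open and $a,b,p,q\in C^\infty(\Omega,\mathbb C)$. The operator identity $$\mathscr B_c=(D+a+b\,\omega)(D+p+q\,\omega)$$ holds on sections of $\Sigma M|_\Omega$ if and only if \begin{align*} a&=-p,\\ b&=q+2\eta,\\ \operatorname{grad}p&=J\operatorname{grad}q,\\ 2\eta(p+H)&=0,\\ p^2+q(q+2\eta)&=H^2+2c-|A|^2 . \end{align*} In particular, if $c\neq0$, every such factorization has $p=-H$.
   Context: $N^3(c)$ is an oriented Riemannian three-dimensional space form of constant sectional curvature $c\in\mathbb R$; $M^2$ is an oriented surface immersed with unit normal $\xi$ and induced metric $g$. The shape operator is $\nabla^N_X\xi=-A(X)$, $H=\frac12\operatorname{tr}A$, $|A|^2=\operatorname{tr}(A^2)$. $\Sigma M$ is the complex spinor bundle of a spin structure on $M$; Clifford multiplication satisfies $X\cdot Y+Y\cdot X=-2g(X,Y)$. $\omega=e_1\cdot e_2$ for a positively oriented orthonormal frame, acting by Clifford multiplication, and $D\Psi=e_1\cdot\nabla_{e_1}\Psi+e_2\cdot\nabla_{e_2}\Psi$. Scalar functions act by multiplication. $J$ is rotation by $+\pi/2$ on $TM$ ($Je_1=e_2$). For complex-valued functions, $\operatorname{grad}$, $J$ and Clifford multiplication are extended complex-linearly. *)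

(* Defs.v *)
From HB Require Import structures.
From mathcomp Require Import all_boot all_order all_algebra.
From mathcomp Require Import all_classical all_reals all_analysis.
From mathcomp.real_closed Require Export complex.
Export numFieldNormedType.Exports.
Set Implicit Arguments.
Unset Strict Implicit.
Unset Printing Implicit Defensive.
Import Order.TTheory GRing.Theory Num.Theory.
Local Open Scope classical_set_scope.
Local Open Scope ring_scope.
Local Open Scope complex_scope.

Section SmoothMaps.
Variables (R : realType) (V W : normedModType R).

(* C^k on an open set [U] of a finite-dimensional [V]: there, continuity of
   the differential is continuity of all directional derivatives. *)
Fixpoint Ck (k : nat) (U : set V) (f : V -> W) : Prop :=
  match k with
  | 0%N => forall x, U x -> {for x, continuous f}
  | k'.+1 => (forall x, U x -> differentiable f x) /\
             (forall v, Ck k' U ('D_v f))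
  end.

Definition smooth_on (U : set V) (f : V -> W) : Prop := forall k, Ck k U f.

End SmoothMaps.

(* Smooth oriented n-manifolds, presented by an oriented atlas. As a total
   function, [param k] is only meaningful on [coord k @` dom k].
   [chart_at x] is a preferred chart at [x]: the tangent space at [x] is
   'rV[R]_n, a vector being given by its components in that chart. *)
Record orientedManifold (R : realType) (n : nat) := OrientedManifold {
  carrier :> topologicalType;
  carrier_hausdorff : hausdorff_space carrier;
  carrier_second_countable : @second_countable carrier;
  chart : Type;
  dom : chart -> set carrier;
  coord : chart -> carrier -> 'rV[R]_n;
  param : chart -> 'rV[R]_n -> carrier;
  chart_at : carrier -> chart;
  dom_chart_at : forall x, dom (chart_at x) x;
  dom_open : forall k, open (dom k);
  image_open : forall k, open (coord k @` dom k);
  coordK : forall k x, dom k x -> param k (coord k x) = x;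
  coord_continuous : forall k x, dom k x -> {for x, continuous (coord k)};
  param_continuous : forall k u, (coord k @` dom k) u ->
    {for u, continuous (param k)};
  transition_smooth : forall k l,
    smooth_on (coord k @` (dom k `&` dom l)) (coord l \o param k);
  transition_oriented : forall k l u, (coord k @` (dom k `&` dom l)) u ->
    0 < \det (jacobian (coord l \o param k) u)
}.

Section Differentials.
Variables (R : realType) (n : nat) (M : orientedManifold R n).

Definition msmooth (W : normedModType R) (U : set M) (f : M -> W) : Prop :=
  forall k, smooth_on (coord k @` (U `&` dom k)) (f \o param k).

(* df_x(v) *)
Definition mder (W : normedModType R) (f : M -> W) (x : M) (v : 'rV[R]_n) : W :=
  'D_v (f \o param (chart_at x)) (coord (chart_at x) x).

Definition csmooth (U : set M) (f : M -> R[i]) : Prop :=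
  msmooth U (fun y => complex.Re (f y)) /\ msmooth U (fun y => complex.Im (f y)).

Definition cder (f : M -> R[i]) (x : M) (v : 'rV[R]_n) : R[i] :=
  Complex (mder (fun y => complex.Re (f y)) x v)
          (mder (fun y => complex.Im (f y)) x v).

End Differentials.

Section TangentMaps.
Variables (R : realType) (m n : nat).
Variables (P : orientedManifold R m) (N : orientedManifold R n).

Definition smooth_map (F : P -> N) : Prop :=
  continuous F /\ forall k, msmooth (F @^-1` dom k) (coord k \o F).

(* dF_x(v), an element of the tangent space at [F x] *)
Definition tmap (F : P -> N) (x : P) (v : 'rV[R]_m) : 'rV[R]_n :=
  mder (coord (chart_at (F x)) \o F) x v.

(* Components in the chart [k] of a vector field along [F], i.e. of
   [Y] with [Y x] tangent to [N] at [F x]. *)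
Definition field_coord (F : P -> N) (Y : P -> 'rV[R]_n) (k : chart N) (x : P)
  : 'rV[R]_n := mder (coord k) (F x) (Y x).

Definition smooth_field (F : P -> N) (U : set P) (Y : P -> 'rV[R]_n) : Prop :=
  forall k, msmooth (U `&` F @^-1` dom k) (field_coord F Y k).

End TangentMaps.

Section Riemannian.
Variables (R : realType) (n : nat) (N : orientedManifold R n).

(* A metric assigns to [x] its Gram matrix in the preferred chart at [x]. *)
Definition inner (h : 'M[R]_n) (v w : 'rV[R]_n) : R := (v *m h *m w^T) 0 0.

Variable g : N -> 'M[R]_n.

(* coordinate vector field along [v] of the chart [k], at [param k u] *)
Definition chart_vec (k : chart N) (u v : 'rV[R]_n) : 'rV[R]_n :=
  'D_v (coord (chart_at (param k u)) \o param k) u.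

Definition chart_metric (k : chart N) (v w u : 'rV[R]_n) : R :=
  inner (g (param k u)) (chart_vec k u v) (chart_vec k u w).

Definition chart_gram (k : chart N) (u : 'rV[R]_n) : 'M[R]_n :=
  \matrix_(i, j) chart_metric k 'e_i 'e_j u.

Definition is_metric : Prop :=
  [/\ forall x, (g x)^T = g x,
      forall x v, v != 0 -> 0 < inner (g x) v v &
      forall k v w, smooth_on (coord k @` dom k) (chart_metric k v w)].

(* Levi-Civita connection in the chart [k]: Gamma_u(v, w), determined by
   2 g(Gamma(v, w), z) = D_v g(w, z) + D_w g(v, z) - D_z g(v, w). *)
Definition christoffel (k : chart N) (u v w : 'rV[R]_n) : 'rV[R]_n :=
  2^-1 *: (\row_i ('D_v (chart_metric k w 'e_i) u +
                   'D_w (chart_metric k v 'e_i) u -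
                   'D_('e_i) (chart_metric k v w) u)
           *m invmx (chart_gram k u)).

(* nabla_X W for a constant field [X] and a field [W] of the chart [k] *)
Definition chart_nabla (k : chart N) (X : 'rV[R]_n)
    (W : 'rV[R]_n -> 'rV[R]_n) (u : 'rV[R]_n) : 'rV[R]_n :=
  'D_X W u + christoffel k u X (W u).

(* R(X, Y) Z = nabla_X nabla_Y Z - nabla_Y nabla_X Z, where the constant fields
   [X] and [Y] commute. *)
Definition chart_curvature (k : chart N) (u X Y Z : 'rV[R]_n) : 'rV[R]_n :=
  chart_nabla k X (chart_nabla k Y (fun=> Z)) u -
  chart_nabla k Y (chart_nabla k X (fun=> Z)) u.

Definition constant_curvature (c : R) : Prop :=
  forall k u X Y, (coord k @` dom k) u ->
    chart_metric k (chart_curvature k u X Y Y) X u =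
    c * (chart_metric k X X u * chart_metric k Y Y u -
         chart_metric k X Y u ^+ 2).

Definition is_geodesic (gamma : R -> N) : Prop :=
  continuous gamma /\
  forall t k, dom k (gamma t) ->
    [/\ derivable (coord k \o gamma) t 1,
        derivable (derive1 (coord k \o gamma)) t 1 &
        derive1 (derive1 (coord k \o gamma)) t +
        christoffel k (coord k (gamma t))
          (derive1 (coord k \o gamma) t) (derive1 (coord k \o gamma) t) = 0].

Definition geodesically_complete : Prop :=
  forall (x : N) (v : 'rV[R]_n), exists gamma : R -> N,
    [/\ is_geodesic gamma, gamma 0 = x &
        derive1 (coord (chart_at x) \o gamma) 0 = v].

Definition is_space_form (c : R) : Prop :=
  [/\ is_metric, connected [set: N], geodesically_complete &
      constant_curvature c].

(* nabla_v Y for a vector field [Y] along [F : P -> N]; the case [F = id] is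
   the Levi-Civita connection of [N]. *)
Definition covd (m : nat) (P : orientedManifold R m) (F : P -> N)
    (Y : P -> 'rV[R]_n) (x : P) (v : 'rV[R]_m) : 'rV[R]_n :=
  mder (field_coord F Y (chart_at (F x))) x v +
  christoffel (chart_at (F x)) (coord (chart_at (F x)) (F x))
    (tmap F x v) (Y x).

End Riemannian.

Section Surface.
Variables (R : realType) (M : orientedManifold R 2) (g : M -> 'M[R]_2).

(* A frame at a point is the matrix whose rows are [e_1] and [e_2]. *)
Definition oriented_orthonormal (x : M) (E : 'M[R]_2) : Prop :=
  E *m g x *m E^T = 1%:M /\ 0 < \det E.

(* [J x] acts on row vectors on the right. *)
Definition is_rotation (J : M -> 'M[R]_2) : Prop :=
  forall x E, oriented_orthonormal x E ->
    row 0 E *m J x = row 1 E /\ row 1 E *m J x = - row 0 E.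

Definition cgrad (f : M -> R[i]) (x : M) : 'rV[R[i]]_2 :=
  (\row_j cder f x 'e_j) *m map_mx (real_complex R) (invmx (g x)).

Definition cJ (J : M -> 'M[R]_2) (x : M) (Z : 'rV[R[i]]_2) : 'rV[R[i]]_2 :=
  Z *m map_mx (real_complex R) (J x).

Section Immersion.
Variables (N : orientedManifold R 3) (gN : N -> 'M[R]_3).

Definition isometric_immersion (phi : M -> N) : Prop :=
  smooth_map phi /\
  forall x v w, inner (gN (phi x)) (tmap phi x v) (tmap phi x w) =
                inner (g x) v w.

Definition unit_normal (phi : M -> N) (xi : M -> 'rV[R]_3) : Prop :=
  [/\ smooth_field phi setT xi,
      forall x, inner (gN (phi x)) (xi x) (xi x) = 1 &
      forall x v, inner (gN (phi x)) (xi x) (tmap phi x v) = 0].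

(* [A x] acts on row vectors on the right. *)
Definition shape_operator (phi : M -> N) (xi : M -> 'rV[R]_3)
    (A : M -> 'M[R]_2) : Prop :=
  forall x v, covd gN phi xi x v = - tmap phi x (v *m A x).

End Immersion.

Definition mean_curvature (A : M -> 'M[R]_2) (x : M) : R := \tr (A x) / 2.

Definition shape_norm2 (A : M -> 'M[R]_2) (x : M) : R := \tr (A x *m A x).

End Surface.

(* The irreducible complex representation of the Clifford algebra of the
   Euclidean plane on C^2: e_1 = ((0, -1), (1, 0)), e_2 = ((0, i), (i, 0)). *)
Definition gamma_mx (R : realType) (k : 'I_2) : 'M[R[i]]_2 :=
  if k == 0 then \matrix_(r, s) (r%:R - s%:R)
  else \matrix_(r, s) (if r == s then 0 else 'i).

Definition omega_mx (R : realType) : 'M[R[i]]_2 := gamma_mx R 0 *m gamma_mx R 1.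

Lemma gamma_clifford (R : realType) (k l : 'I_2) :
  gamma_mx R k *m gamma_mx R l + gamma_mx R l *m gamma_mx R k =
  (- (2 * (k == l)%:R))%:M.
Proof.
have ii : 'i * 'i = -1 :> R[i] by rewrite -expr2 sqr_i.
have i2 (i : 'I_2) : i = 0 \/ i = 1.
  by case: i => [[|[|i]] Hi] //; [left|right]; apply/val_inj.
apply/matrixP => r s.
rewrite !mxE !big_ord_recl !big_ord0 /gamma_mx.
case: (i2 k) => ->; case: (i2 l) => ->; case: (i2 r) => ->; case: (i2 s) => ->;
  rewrite /= !mxE /= ?mulr0n ?mulr1n ?ii ?subr0 ?sub0r ?subrr;
  rewrite ?(mul0r, mulr0, mul1r, mulr1, mulrN1, mulN1r, addr0, add0r, subr0,
            sub0r, addNr, addrN, opprK, oppr0) //; by rewrite -opprD.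
Qed.

Section Spin.
Variables (R : realType) (M : orientedManifold R 2) (g : M -> 'M[R]_2).

Definition rot_mx (z : R[i]) : 'M[R]_2 :=
  \matrix_(r, s) (if r == s then complex.Re z
                  else if r == 0 then complex.Im z else - complex.Im z).

(* A spin structure, i.e. a lift of the oriented orthonormal frame bundle
   through Spin(2) -> SO(2), in terms of local data. Spin(2) consists of the
   elements Re u + Im u e_1 e_2 with |u| = 1, and such an element acts on the
   plane as the rotation by u^2. *)
Record spinStructure := SpinStructure {
  trivn : Type;
  trivdom : trivn -> set M;
  frame : trivn -> M -> 'M[R]_2;
  spin_lift : trivn -> trivn -> M -> R[i];
  trivdom_open : forall al, open (trivdom al);
  trivdom_cover : forall x, exists al, trivdom al x;
  frame_smooth : forall al (r : 'I_2),
    smooth_field id (trivdom al) (fun x => row r (frame al x));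
  frame_on : forall al x, trivdom al x ->
    oriented_orthonormal g x (frame al x);
  spin_lift_smooth : forall al be,
    csmooth (trivdom al `&` trivdom be) (spin_lift al be);
  spin_lift_norm : forall al be x, trivdom al x -> trivdom be x ->
    `|spin_lift al be x| = 1;
  spin_lift_frame : forall al be x, trivdom al x -> trivdom be x ->
    frame be x = rot_mx (spin_lift al be x ^+ 2) *m frame al x;
  spin_lift_cocycle : forall al be ga x,
    trivdom al x -> trivdom be x -> trivdom ga x ->
    spin_lift al be x * spin_lift be ga x = spin_lift al ga x
}.

Variable S : spinStructure.

(* A spinor field is given by its components in the trivializations of the
   spinor bundle induced by [S]. *)
Definition spinor := trivn S -> M -> 'cV[R[i]]_2.

Definition spin_mx (u : R[i]) : 'M[R[i]]_2 :=
  ((complex.Re u)%:C)%:M + (complex.Im u)%:C *: omega_mx R.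

Definition is_section (Om : set M) (psi : spinor) : Prop :=
  (forall al r, csmooth (Om `&` trivdom al) (fun x => psi al x r 0)) /\
  (forall al be x, Om x -> trivdom al x -> trivdom be x ->
     psi al x = spin_mx (spin_lift al be x) *m psi be x).

(* nabla_v psi = d psi(v) + 1/2 g(nabla_v e_1, e_2) e_1 . e_2 . psi *)
Definition spin_nabla (psi : spinor) (al : trivn S) (x : M) (v : 'rV[R]_2)
  : 'cV[R[i]]_2 :=
  \col_r cder (fun y => psi al y r 0) x v +
  (inner (g x) (covd g id (fun y => row 0 (frame al y)) x v)
               (row 1 (frame al x)) / 2)%:C *: (omega_mx R *m psi al x).

Definition dirac (psi : spinor) : spinor := fun al x =>
  \sum_(k < 2) gamma_mx R k *m spin_nabla psi al x (row k (frame al x)).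

Definition omega (psi : spinor) : spinor := fun al x => omega_mx R *m psi al x.

Definition fmul (f : M -> R[i]) (psi : spinor) : spinor :=
  fun al x => f x *: psi al x.

(* D + a + b omega *)
Definition dirac_factor (a b : M -> R[i]) (psi : spinor) : spinor :=
  dirac psi + fmul a psi + fmul b (omega psi).

Definition B_op (c : R) (eta : R[i]) (A : M -> 'M[R]_2) (psi : spinor)
  : spinor :=
  dirac (dirac psi)
  + fmul (fun=> 2 * eta) (omega (dirac psi))
  - fmul (fun x => 2 * eta * (mean_curvature A x)%:C) (omega psi)
  + fmul (fun x => (shape_norm2 A x - mean_curvature A x ^+ 2 - 2 * c)%:C) psi.

Definition eq_on_sections (Om : set M) (P Q : spinor -> spinor) : Prop :=
  forall psi, is_section Om psi ->
  forall al x, Om x -> trivdom al x -> P psi al x = Q psi al x.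

End Spin.

(* Main.v *)
Require Import Defs.
From mathcomp Require Import all_boot all_order all_algebra.
From mathcomp Require Import all_classical all_reals all_analysis.
From mathcomp Require Import ring lra.
(* Imported again because [vector.coord] shadows [Defs.coord]. *)
Import Defs.
Set Implicit Arguments.
Unset Strict Implicit.
Unset Printing Implicit Defensive.
Import Order.TTheory GRing.Theory Num.Theory.
Local Open Scope classical_set_scope.
Local Open Scope ring_scope.
Local Open Scope complex_scope.

(** Since D anticommutes with omega and D(f psi) = grad f . psi + f D psi,
    the difference of the two second-order operators has order one:
      (D + a + b omega)(D + p + q omega) - B_c = L D + N,
      L = (a + p) + (b - q - 2 eta) omega,
      N = m + n omega + grad p + (grad q) . omega,  m and n functions.
    Both L and N are matrices in the basis 1, omega, e_1, e_2 of the Clifford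
    algebra, so the five equations say exactly that L = N = 0. Bump sections
    with prescribed value and first derivative at a point show that the
    operator vanishes only if L and then N do.

    Leibniz' rule for the outer D requires D psi to be differentiable. The
    connection form is defined through the preferred chart of each point, but
    Koszul's formula gives g(nabla_{e_i} e_1, e_2) = - g(e_i, [e_1, e_2]), and
    the bracket transforms like a vector under a change of chart by the
    symmetry of second derivatives; so it is smooth in any fixed chart. *)

(** * Maps of class C^k *)

(** The last three equations are N = 0 rewritten. With a = -p and b = q + 2 eta, n = a q + b p + 2
    eta H collapses to 2 eta (p + H), and m = a p - b q - (|A|^2 - H^2 - 2c) to -(p^2 + q (q + 2
    eta)) + H^2 + 2c - |A|^2. The vector part uses e_1 omega = -e_2 and e_2 omega = e_1.

    D psi at a point contains the connection form, so psi and D psi are not the independent data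
    there; the value and the derivative of psi are. A test section with zero derivative gives only L
    C + N = 0, where C is the connection part of D. A nonzero derivative then isolates L times a
    Clifford generator, which is invertible; so L = 0 and N = 0 follows.

    Test sections must live on all of [Om], while transition matrices of spinors are meaningful only
    on overlaps. Hence the bump has support in a closed set inside one chart and one trivialization.
    Its derivative is prescribed by moving the centre of a radial bump off the point. *)

Section NearDiff.
Variables (R : realType) (V W : normedModType R).

(** The expansion f(x + h) = f x + df(h) + o(h) depends only on the germ of the function at [x], and
    it determines the differential. *)
Lemma near_eq_diff (f g : V -> W) (x : V) : (\near x, f x = g x) ->
  differentiable f x -> differentiable g x.
Proof.
move=> fg df.
have [dfc fE] := (diff_locallyP x f).1 df.
have gE : g \o shift x = cst (g x) + 'd f x +o_ 0 id.
  apply/eqaddoP => e e0; have/eqaddoP/(_ _ e0) := fE.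
  apply: filter_app.
  have : \forall y \near 0, f (y + x) = g (y + x).
    by move: fg; rewrite (near_shift 0)/= subr0.
  apply: filter_app; apply: nearW => y /= fgy.
  rewrite /= !fctE /= fgy.
  by rewrite (nbhs_singleton fg).
have dE := diff_unique dfc gE.
by apply/diff_locallyP; rewrite dE.
Qed.

Lemma near_eq_deriv (f g : V -> W) (x : V) : (\near x, f x = g x) ->
  \forall y \near x, forall v, 'D_v f y = 'D_v g y.
Proof.
move=> /near_join; apply: filterS => y fg v.
exact: near_eq_derive.
Qed.

Lemma near_eq_continuous_at (f g : V -> W) (x : V) : (\near x, f x = g x) ->
  {for x, continuous f} -> {for x, continuous g}.
Proof.
move=> fg cf; rewrite /prop_for /continuous_at -(nbhs_singleton fg).
by apply: cvg_trans cf; apply: near_eq_cvg.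
Qed.

(** Derivatives are those of the total function, so [Ck] is a condition on its germ at each point of
    the set. Hence [U'] and [g] may vary with the point. This is the tool for replacing one formula
    by another and for gluing a bump to zero. *)
Lemma Ck_local k (U : set V) (f : V -> W) :
  (forall x, U x -> exists (U' : set V) (g : V -> W),
     [/\ U' x, Ck k U' g & \near x, f x = g x]) -> Ck k U f.
Proof.
elim: k f => [|k IH] f H /=.
  move=> x /H[U' [g [U'x cg fg]]].
  apply: near_eq_continuous_at (cg _ U'x); by move: fg; apply: filterS => y ->.
split=> [x /H[U' [g [U'x [cg _] fg]]]|v].
  apply: near_eq_diff (cg _ U'x); by move: fg; apply: filterS => y ->.
apply: IH => x /H[U' [g [U'x [_ cg] fg]]].
exists U', ('D_v g); split; [exact: U'x|exact: cg|].
have gf : \forall y \near x, f y = g y by move: fg; apply: filterS => y ->.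
by have := near_eq_deriv gf; apply: filterS => y ->.
Qed.

Lemma Ck_sub k (U U' : set V) (f : V -> W) : U' `<=` U -> Ck k U f -> Ck k U' f.
Proof.
move=> UU cf; apply: Ck_local => x U'x; exists U, f; split=> //; first exact: UU.
exact: nearW.
Qed.

Lemma Ck_eq k (U : set V) (f g : V -> W) : open U ->
  (forall x, U x -> f x = g x) -> Ck k U f -> Ck k U g.
Proof.
move=> oU fg cf; apply: Ck_local => x Ux; exists U, f; split=> //.
by apply: filterS (open_nbhs_nbhs (conj oU Ux)) => y Uy; rewrite fg.
Qed.

Lemma CkS k (U : set V) (f : V -> W) : Ck k.+1 U f -> Ck k U f.
Proof.
elim: k f => [|k IH] f [df cf] /=.
  by move=> x /df; exact: differentiable_continuous.
by split=> // v; apply: IH; exact: cf.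
Qed.

Lemma Ck_cst k (U : set V) (c : W) : Ck k U (cst c).
Proof.
elim: k c => [|k IH] c /=; first by move=> x _; exact: cvg_cst.
split=> // v; rewrite (_ : 'D_v (cst c) = cst 0) //.
by apply/funext => x; rewrite derive_cst.
Qed.

Lemma Ck_add k (U : set V) (f g : V -> W) : open U ->
  Ck k U f -> Ck k U g -> Ck k U (f + g).
Proof.
move=> oU; elim: k f g => [|k IH] f g /=.
  by move=> cf cg x Ux; apply: continuousD; [exact: cf|exact: cg].
move=> [df cf] [dg cg]; split=> [x Ux|v].
  by apply: differentiableD; [exact: df|exact: dg].
apply: Ck_eq (IH _ _ (cf v) (cg v)) => // x Ux; rewrite [RHS]deriveD//.
- by apply: diff_derivable; exact: df.
- by apply: diff_derivable; exact: dg.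
Qed.

End NearDiff.

Section RealDiff.
Variables (R : realType) (V : normedModType R).
Implicit Types (U : set V) (f g : V -> R).

Lemma Ck_mul k U f g : open U -> Ck k U f -> Ck k U g -> Ck k U (f * g).
Proof.
move=> oU; elim: k f g => [|k IH] f g.
  by move=> cf cg x Ux; apply: continuousM; [exact: cf|exact: cg].
move=> cf0 cg0; have [df cf] := cf0; have [dg cg] := cg0; split=> [x Ux|v].
  by apply: differentiableM; [exact: df|exact: dg].
have := Ck_add oU (IH _ _ (CkS cf0) (cg v)) (IH _ _ (CkS cg0) (cf v)).
apply: Ck_eq => // x Ux; rewrite [RHS]deriveM//.
- by apply: diff_derivable; exact: df.
- by apply: diff_derivable; exact: dg.
Qed.

Lemma Ck_opp k U f : open U -> Ck k U f -> Ck k U (- f).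
Proof.
move=> oU cf; have := Ck_mul oU (@Ck_cst R V R^o k U (-1 : R)) cf.
by apply: Ck_eq => // x _; rewrite !fctE mulN1r.
Qed.

Lemma Ck_sum k U n (f : 'I_n -> V -> R) : open U ->
  (forall i, Ck k U (f i)) -> Ck k U (\sum_i f i).
Proof.
move=> oU cf; apply: (big_ind (Ck k U)) => [|f1 f2 c1 c2|i _]; last exact: cf.
- exact: (@Ck_cst R V R^o k U 0).
- exact: Ck_add.
Qed.

End RealDiff.

Section Coordinates.
Variables (R : realType) (V : normedModType R) (n : nat).

Lemma diff_entry (f : V -> 'rV[R]_n) x i : differentiable f x ->
  differentiable (fun y => f y 0 i) x.
Proof.
move=> df; have dc := differentiable_coord (f x) 0 i.
exact: (differentiable_comp df dc).
Qed.

Lemma derive_entry (f : V -> 'rV[R]_n) x v i : differentiable f x ->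
  'D_v (fun y => f y 0 i) x = 'D_v f x 0 i.
Proof. by move=> df; rewrite derive_mx ?mxE//; exact: diff_derivable. Qed.

Lemma Ck_entry k (U : set V) (f : V -> 'rV[R]_n) i : open U -> Ck k U f ->
  Ck k U (fun y => f y 0 i).
Proof.
move=> oU; elim: k f => [|k IH] f /=.
  move=> cf x /cf cfx.
  by apply: (@continuous_comp _ _ _ f (fun M : 'rV[R]_n => M 0 i)) cfx _; exact: matrix_normedtype.coord_continuous.
move=> [df cf]; split=> [x /df|v]; first exact: diff_entry.
apply: Ck_eq (IH _ (cf v)) => // x /df dfx.
by rewrite derive_entry.
Qed.

End Coordinates.

(** * Flat functions, the source of smooth cut-offs *)

Section Flat.
Variable R : realType.

(* This family is closed under differentiation, see [dflat]. *)
Definition flat (n : nat) (t : R) : R :=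
  if 0 < t then t^-1 ^+ n * expR (- t^-1) else 0.

Lemma flat_pos n t : 0 < t -> 0 < flat n t.
Proof.
by move=> t0; rewrite /flat t0 mulr_gt0 ?expR_gt0// exprn_gt0// invr_gt0.
Qed.

Lemma flat_npos n t : t <= 0 -> flat n t = 0.
Proof. by move=> t0; rewrite /flat ltNge t0. Qed.

(** The exponential series gives exp s >= s^(n+2) / (n+2)! for s = 1/t. The two spare powers of [t]
    make the difference quotient of [flat n] at 0 tend to 0. *)
Lemma flat_bound n (t : R) : `|flat n t| <= (n.+2)`!%:R * t ^+ 2.
Proof.
rewrite /flat; case: ifPn => [t0|_]; last by rewrite normr0 mulr_ge0// sqr_ge0.
have s0 : 0 < t^-1 by rewrite invr_gt0.
rewrite ger0_norm; last by rewrite mulr_ge0 ?expR_ge0// exprn_ge0// ltW.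
have := @expR_ge1Dxn _ t^-1 n.+1 (ltW s0).
set F := (n.+2)`!%:R : R => H.
have F0 : 0 < F by rewrite ltr0n fact_gt0.
have {}H : t^-1 ^+ n.+2 <= F * expR (t^-1).
  rewrite mulrC -ler_pdivrMr//; apply: le_trans H; lra.
rewrite expRN ler_pdivrMr ?expR_gt0// mulrAC -ler_pdivrMr ?exprn_gt0//.
by rewrite -exprVn -exprD addn2.
Qed.

Definition dflat n (t : R) := - n%:R * flat n.+1 t + flat n.+2 t.

Lemma flat_is_derive n (t : R) : is_derive t 1 (flat n) (dflat n t).
Proof.
have [t0|t0|t0] := ltgtP t 0.
- have -> : dflat n t = 0.
    by rewrite /dflat !flat_npos ?ltW// mulr0 addr0.
  have d0 : is_derive t 1 (cst 0 : R -> R) 0.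
    by split; [exact: derivable_cst|exact: derive_cst].
  apply: near_eq_is_derive d0.
  by near=> s; rewrite flat_npos// ltW//; near: s; exact: lt_nbhsl.
- have tn0 : t != 0 by rewrite gt_eqF.
  have dV : is_derive t 1 (fun s : R => s^-1) (- t^-1 ^+ 2).
    apply: is_derive_eq; first by apply: is_deriveV.
    by rewrite -exprVn scaler1.
  have dN : is_derive t 1 (fun s : R => - s^-1) (t^-1 ^+ 2).
    by apply: is_derive_eq; rewrite opprK.
  have dE : is_derive t 1 (fun s : R => expR (- s^-1)) (expR (- t^-1) * t^-1 ^+ 2).
    by apply: (@is_derive1_comp _ expR (fun s : R => - s^-1)).
  have dX := @is_deriveX _ _ (fun s : R => s^-1) n t 1 _ dV.
  suff d1 : is_derive t 1 (fun s : R => s^-1 ^+ n * expR (- s^-1)) (dflat n t).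
    apply: near_eq_is_derive d1.
    by near=> s; rewrite /flat ifT//; near: s; exact: lt_nbhsr.
  rewrite (_ : (fun _ => _) =
    ((fun s : R => s^-1) ^+ n * (fun s : R => expR (- s^-1)))); last first.
    by apply/funext => s; rewrite !fctE.
  apply: (is_derive_eq (is_deriveM dX dE)).
  rewrite /dflat /flat t0 !fctE /= /GRing.scale /=.
  move: (t^-1) (expR _) => s E; clear; case: n => [|n] /=; rewrite !exprS.
    ring.
  ring.
- rewrite t0.
  have -> : dflat n 0 = 0 by rewrite /dflat !flat_npos// mulr0 addr0.
  set F := (n.+2)`!%:R : R.
  have F0 : 0 < F by rewrite ltr0n fact_gt0.
  (* By [flat_bound] the quotient is at most F |h| in absolute value, so |h| <= e / F suffices. *)
  have H : (fun h => h^-1 *: ((flat n \o shift 0) (h *: 1) - flat n 0)) @ 0^' --> (0 : R).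
    apply/cvgrPdist_le => e e0; near=> h.
    rewrite sub0r normrN /= (flat_npos _ (lexx 0)) subr0 addr0 /GRing.scale /= mulr1.
    have h0 : h != 0 by near: h; exact: nbhs_dnbhs_neq.
    rewrite normrM normfV ler_pdivrMl ?normr_gt0//.
    apply: (le_trans (flat_bound _ _)).
    rewrite -real_normK ?num_real// expr2 mulrCA ler_pM2l ?normr_gt0//.
    rewrite -ler_pdivlMl//; near: h; apply: dnbhs0_le.
    by rewrite mulr_gt0// invr_gt0.
  split; last exact: cvg_lim H.
  by apply/cvg_ex; exists 0.
Unshelve. all: by end_near. Qed.

Lemma flat_differentiable n (t : R) : differentiable (flat n) t.
Proof. by apply/derivable1_diffP; case: (flat_is_derive n t). Qed.

Lemma derive_flat_comp (V : normedModType R) n (Q : V -> R) x v :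
  differentiable Q x -> 'D_v (flat n \o Q) x = dflat n (Q x) * 'D_v Q x.
Proof.
move=> dQ; have df := flat_differentiable n (Q x).
rewrite deriveE; last exact: differentiable_comp.
rewrite diff_comp//= -(deriveE v dQ).
set y := 'D_v Q x.
have -> : 'd (flat n) (Q x) y = y * 'd (flat n) (Q x) 1.
  by rewrite -[in LHS](mulr1 y); exact: linearZ.
rewrite -deriveE// (@derive_val _ _ _ _ _ _ _ (flat_is_derive n (Q x))).
by rewrite mulrC.
Qed.

(** The induction on [k] must quantify over [n]: differentiating [flat n] brings in [flat n.+1] and
    [flat n.+2]. *)
Lemma Ck_flat (V : normedModType R) k (U : set V) (Q : V -> R) n :
  open U -> Ck k U Q -> Ck k U (flat n \o Q).
Proof.
move=> oU; elim: k n => [|k IH] n cQ.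
  move=> x Ux; apply: continuous_comp; first exact: cQ.
  by apply: differentiable_continuous; exact: flat_differentiable.
have [dQ cQ'] := cQ.
split=> [x Ux|v].
  by apply: differentiable_comp; [exact: dQ|exact: flat_differentiable].
have cf m := IH m (CkS cQ).
have c1 := Ck_mul oU (Ck_add oU (Ck_mul oU (@Ck_cst R V R^o k U (- n%:R : R)) (cf n.+1)) (cf n.+2)) (cQ' v).
apply: Ck_eq c1 => // x Ux; rewrite derive_flat_comp//; exact: dQ.
Qed.

End Flat.

(** * Symmetry of second derivatives *)

Section Schwarz.
Variables (R : realType) (V : normedModType R) (f : V -> R) (U : set V).

Lemma is_derive_line (F : V -> R) (y v : V) (t : R) :
  differentiable F (y + t *: v) ->
  is_derive t 1 (fun s => F (y + s *: v)) ('D_v F (y + t *: v)).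
Proof.
move=> dF.
have E : (fun h : R => h^-1 *: (((fun s => F (y + s *: v)) \o shift t) (h *: 1) - F (y + t *: v)))
  = (fun h => h^-1 *: ((F \o shift (y + t *: v)) (h *: v) - F (y + t *: v))).
  apply/funext => h /=; congr (_ *: (F _ - _)).
  by rewrite scalerDl addrCA /GRing.scale /= mulr1.
have := @diff_derivable _ _ _ _ _ v dF; rewrite /derivable -E => H.
split; first exact: H.
by rewrite /derive -E.
Qed.

Hypotheses (oU : open U) (cf : Ck 2 U f).

(** Two applications of the mean value theorem: along [v] to the increment of [f] over h w, then
    along [w] to ['D_v f]. Up to the order of its middle terms the left side is symmetric in [v] and
    [w]. *)
Lemma second_difference (x v w : V) (h : R) : 0 < h ->
  (forall s t, 0 <= s <= h -> 0 <= t <= h -> U (x + s *: v + t *: w)) ->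
  exists s t, [/\ 0 <= s <= h, 0 <= t <= h &
   f (x + h *: v + h *: w) - f (x + h *: v) - f (x + h *: w) + f x =
   h * (h * 'D_w ('D_v f) (x + s *: v + t *: w))].
Proof.
move=> h0 HU; have [df [d2 _]] : _ /\ _ := conj cf.1 (cf.2 v).
have hh : 0 <= h <= h by rewrite lexx ltW.
have h00 : 0 <= (0:R) <= h by rewrite lexx ltW.
pose phi s := f (x + h *: w + s *: v) - f (x + s *: v).
have dphi s : 0 <= s <= h -> is_derive s 1 phi
    ('D_v f (x + s *: v + h *: w) - 'D_v f (x + s *: v)).
  move=> sh; rewrite (addrAC x (s *: v)); apply: is_deriveB.
  - by apply: is_derive_line; apply: df; rewrite addrAC; exact: HU.
  - apply: is_derive_line; apply: df.
    by have := HU s 0 sh h00; rewrite scale0r addr0.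
have cphi : {within `[0, h], continuous phi}.
  by apply: derivable_within_continuous => s; rewrite in_itv => /dphi[].
have [|s] := MVT_segment (ltW h0) _ cphi (df := fun s => 'D_v f (x + s *: v + h *: w) - 'D_v f (x + s *: v)).
  by move=> s; rewrite in_itv /= => /andP[s0 sh]; apply: dphi; rewrite !ltW.
rewrite in_itv /= => sh; rewrite subr0 => E1.
pose psi t := 'D_v f (x + s *: v + t *: w).
have dpsi t : 0 <= t <= h -> is_derive t 1 psi ('D_w ('D_v f) (x + s *: v + t *: w)).
  by move=> th; apply: is_derive_line; apply: d2; exact: HU.
have cpsi : {within `[0, h], continuous psi}.
  by apply: derivable_within_continuous => t; rewrite in_itv => /dpsi[].
have [|t] := MVT_segment (ltW h0) _ cpsi (df := fun t => 'D_w ('D_v f) (x + s *: v + t *: w)).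
  by move=> t; rewrite in_itv /= => /andP[t0 th]; apply: dpsi; rewrite !ltW.
rewrite in_itv /= => th; rewrite subr0 /psi scale0r addr0 => E2.
exists s, t; split=> //.
move: E1; rewrite E2 /phi !scale0r !addr0 (addrAC x (h *: w)) => E1.
rewrite [RHS]mulrC [_ * h in RHS](_ : _ = ('D_w ('D_v f) (x + s *: v + t *: w) * h * h)); last ring.
rewrite -E1; ring.
Qed.

(** One and the same second difference is h^2 times either mixed derivative, each taken somewhere in
    a small parallelogram at [x]. By continuity both are within e / 2 of their values at [x]. *)
Lemma schwarz x v w : U x -> 'D_v ('D_w f) x = 'D_w ('D_v f) x.
Proof.
move=> Ux; apply/eqP; rewrite -subr_eq0 -normr_le0; apply/ler_addgt0Pl => e e0.
rewrite addr0.
have e20 : 0 < e / 2 by rewrite divr_gt0.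
have c1 : {for x, continuous ('D_w ('D_v f))} by have [_ H] := cf.2 v; exact: (H w x Ux).
have c2 : {for x, continuous ('D_v ('D_w f))} by have [_ H] := cf.2 w; exact: (H v x Ux).
have : \forall y \near x, [/\ U y, `|'D_w ('D_v f) x - 'D_w ('D_v f) y| <= e / 2
   & `|'D_v ('D_w f) x - 'D_v ('D_w f) y| <= e / 2].
  have n1 := open_nbhs_nbhs (conj oU Ux).
  have n2 := (cvgrPdist_le _ _).1 c1 _ e20.
  have n3 := (cvgrPdist_le _ _).1 c2 _ e20.
  near=> y; split; [exact: (near n1 y)|exact: (near (n2 _) y)|exact: (near (n3 _) y)].
move=> /nbhs_ballP[d /= d0 Hd].
(* Small enough for the parallelogram spanned by h v and h w at [x] to stay in the ball of radius
   [d]; the 1 keeps the denominator positive when [v] and [w] vanish. *)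
pose h := d / (2 * (`|v| + `|w| + 1)).
have n0 : 0 < `|v| + `|w| + 1 by rewrite ltr_wpDl// addr_ge0.
have h0 : 0 < h by rewrite divr_gt0// mulr_gt0.
have hd : h * (`|v| + `|w|) < d.
  rewrite /h -mulrA mulrC -ltr_pdivlMr// divff ?gt_eqF// invfM.
  rewrite mulrAC ltr_pdivrMr// mul1r mulrC ltr_pdivrMr//; nra.
have B s t : 0 <= s <= h -> 0 <= t <= h -> ball x d (x + s *: v + t *: w).
  move=> /andP[s0 sh] /andP[t0 th]; rewrite -ball_normE /= -addrA opprD addNKr normrN.
  apply: le_lt_trans hd; rewrite mulrDr (le_trans (ler_normD _ _))//.
  by rewrite !normrZ lerD// ler_wpM2r// ger0_norm.
have [|s [t [sh th E1]]] := @second_difference x v w h h0.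
  by move=> s t sh th; case: (Hd _ (B _ _ sh th)).
have [|s' [t' [sh' th' E2]]] := @second_difference x w v h h0.
  by move=> s' t' sh' th'; rewrite addrAC; case: (Hd _ (B _ _ th' sh')).
have : 'D_w ('D_v f) (x + s *: v + t *: w) = 'D_v ('D_w f) (x + s' *: w + t' *: v).
  apply: (@mulfI _ h); first by rewrite gt_eqF.
  apply: (@mulfI _ h); first by rewrite gt_eqF.
  apply: etrans (esym E1) _; apply: etrans _ E2.
  by rewrite (addrAC x (h *: w)); congr (_ + f x); exact: addrAC.
rewrite (addrAC x (s' *: w)).
have [_ + _] := Hd _ (B _ _ sh th); have [_ _] := Hd _ (B _ _ th' sh').
set A1 := 'D_w ('D_v f) x; set A2 := 'D_v ('D_w f) x.
move=> H1 H2 E; rewrite E in H2; move: H1 H2.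
move: ('D_v ('D_w f) _) A1 A2 => Z A1 A2 H1 H2.
rewrite (_ : A2 - A1 = (A2 - Z) - (A1 - Z)); last by ring.
apply: le_trans (ler_normB _ _) _; rewrite (splitr e).
exact: lerD.
Unshelve. all: by end_near. Qed.

End Schwarz.

(** * Linearity in the direction, and the product rule for pairings *)

Section Linearity.
Variables (R : realType) (n : nat).

Lemma diff_linear (V W : normedModType R) (F : V -> W) u a v w :
  differentiable F u -> 'D_(a *: v + w) F u = a *: 'D_v F u + 'D_w F u.
Proof. by move=> dF; rewrite !deriveE// linearP. Qed.

Lemma derive_sum_basis (W : normedModType R) (F : 'rV[R]_n -> W) u v :
  differentiable F u -> 'D_v F u = \sum_i v 0 i *: 'D_('e_i) F u.
Proof.
move=> dF; rewrite deriveE// {1}(row_sum_delta v) linear_sum.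
by apply: eq_bigr => i _; rewrite linearZ deriveE.
Qed.

Lemma derive_comp (U V W : normedModType R) (f : U -> V) (F : V -> W) u v :
  differentiable f u -> differentiable F (f u) ->
  'D_v (F \o f) u = 'D_('D_v f u) F (f u).
Proof.
move=> df dF; rewrite deriveE; last exact: differentiable_comp.
by rewrite diff_comp//= !deriveE.
Qed.

Section Pairing.
Variables (V : normedModType R) (G : 'rV[R]_n -> V -> R) (X : V -> 'rV[R]_n) (u : V).
Hypotheses (GL : \forall y \near u, forall v, G v y = \sum_i v 0 i * G 'e_i y)
  (dG : forall v, differentiable (G v) u)
  (dX : forall i, differentiable (fun y => X y 0 i) u).

Let E : \forall y \near u, (\sum_i (fun z => X z 0 i) * G 'e_i) y = G (X y) y.
Proof. by move: GL; apply: filterS => y H; rewrite H fct_sumE. Qed.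

Let dE i : differentiable ((fun z => X z 0 i) * G 'e_i) u.
Proof. exact: differentiableM. Qed.

(** Expanded in the standard basis, the map is a sum of products of differentiable functions. [G]
    will be a metric paired with a vector or a directional derivative; these are known to be linear
    in [v] only near [u], hence the form of [GL]. *)
Lemma diff_pairing : differentiable (fun y => G (X y) y) u.
Proof. by apply: near_eq_diff E _; apply: differentiable_sum. Qed.

Lemma derive_pairing w : differentiable X u ->
  'D_w (fun y => G (X y) y) u = G ('D_w X u) u + 'D_w (G (X u)) u.
Proof.
move=> dXu; rewrite -(near_eq_derive _ E) derive_sum; last first.
  by move=> i; apply: diff_derivable.
have E2 : \forall y \near u, (\sum_i (X u 0 i *: G 'e_i)) y = G (X u) y.
  by move: GL; apply: filterS => y ->; rewrite fct_sumE.
rewrite -(near_eq_derive _ E2) derive_sum; last first.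
  by move=> i; apply/derivableZ/diff_derivable.
rewrite (nbhs_singleton GL) -big_split; apply: eq_bigr => i _ /=.
rewrite deriveM; [|exact: diff_derivable|exact: diff_derivable].
rewrite deriveZ; last exact: diff_derivable.
by rewrite derive_entry// addrC /GRing.scale /= [G _ _ * _]mulrC.
Qed.

End Pairing.

End Linearity.

#[local] Opaque derive.

(** * Changes of chart *)

Section Charts.
Variables (R : realType) (n : nat) (M : orientedManifold R n).
Implicit Types (k l : chart M) (x y : M) (V : set M).

(** [param k] is meaningful only on the image of the chart, so identities between chart expressions
    are stated as identities of germs at [coord k y]. This lemma turns an open condition on the
    manifold into one on such a germ. *)
Lemma near_param k y V : dom k y -> open V -> V y ->
  \forall u \near coord k y, [/\ (coord k @` dom k) u, V (param k u) & dom k (param k u)].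
Proof.
move=> ky oV Vy.
have iy : (coord k @` dom k) (coord k y) by exists y.
have c := param_continuous iy.
have n1 : nbhs (coord k y) (coord k @` dom k).
  by apply: open_nbhs_nbhs; split => //; exact: image_open.
have n2 : \forall u \near coord k y, V (param k u).
  by apply: c; rewrite coordK//; exact: open_nbhs_nbhs.
have n3 : \forall u \near coord k y, dom k (param k u).
  apply: c; rewrite coordK//; apply: open_nbhs_nbhs; split=> //; exact: dom_open.
by near=> u; split; [exact: (near n1 u)|exact: (near n2 u)|exact: (near n3 u)].
Unshelve. all: by end_near. Qed.

Lemma paramK k u : (coord k @` dom k) u -> coord k (param k u) = u.
Proof. by move=> [y ky <-]; rewrite coordK. Qed.

Lemma open_coord_image k V : open V -> open (coord k @` (V `&` dom k)).
Proof.
move=> oV; rewrite openE => _ [y [Vy ky] <-]; rewrite /interior /=.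
have := near_param ky oV Vy; apply: filterS => u [iu Vu ku].
by exists (param k u) => //; exact: paramK.
Qed.

Lemma open_transition_dom k l : open (coord k @` (dom k `&` dom l)).
Proof. by rewrite setIC; apply: open_coord_image; exact: dom_open. Qed.

Definition transition k l := coord l \o param k.

Lemma transition_diff k l y : dom k y -> dom l y ->
  differentiable (transition k l) (coord k y).
Proof.
move=> ky ly; have [d _] := @transition_smooth _ _ M k l 1.
by apply: d; exists y.
Qed.

(** The Jacobian of the transition map: it takes the components of a tangent vector at [y] from the
    chart [k] to the chart [l]. A stored vector has its components in [chart_at y]. *)
Definition ctrans k l y v := 'D_v (transition k l) (coord k y).

Lemma ctrans_linear k l y a v w : dom k y -> dom l y ->
  ctrans k l y (a *: v + w) = a *: ctrans k l y v + ctrans k l y w.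
Proof. by move=> ky ly; apply: diff_linear; exact: transition_diff. Qed.

Lemma near_change_chart (W : Type) (F : M -> W) k l y : dom k y -> dom l y ->
  \forall u \near coord k y, ((F \o param l) \o transition k l) u = (F \o param k) u.
Proof.
move=> ky ly; have := near_param ky (dom_open l) ly.
by apply: filterS => u [_ lu _] /=; rewrite coordK.
Qed.

Section ChangeChart.
Variables (W : normedModType R) (F : M -> W) (k l : chart M) (y : M).
Hypotheses (ky : dom k y) (ly : dom l y)
  (dF : differentiable (F \o param l) (coord l y)).

Let dF' : differentiable (F \o param l) (transition k l (coord k y)).
Proof. by rewrite /transition /= coordK. Qed.

Lemma diff_change_chart : differentiable (F \o param k) (coord k y).
Proof.
apply: near_eq_diff (near_change_chart F ky ly) _.
by apply: differentiable_comp => //; exact: transition_diff.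
Qed.

Lemma derive_change_chart v :
  'D_v (F \o param k) (coord k y) = 'D_(ctrans k l y v) (F \o param l) (coord l y).
Proof.
rewrite -(near_eq_derive _ (near_change_chart F ky ly)) derive_comp//.
  by rewrite (_ : transition k l (coord k y) = coord l y)// /transition/= coordK.
exact: transition_diff.
Qed.

End ChangeChart.

Lemma ctrans_comp j k l y v : dom j y -> dom k y -> dom l y ->
  ctrans k l y (ctrans j k y v) = ctrans j l y v.
Proof.
by move=> jy ky ly; rewrite -[LHS]derive_change_chart//; exact: transition_diff.
Qed.

Lemma ctrans_id k y v : dom k y -> ctrans k k y v = v.
Proof.
move=> ky; rewrite /ctrans -[RHS](derive_id (coord k y) v).
apply: near_eq_derive; have := near_param ky (dom_open k) ky.
by apply: filterS => u [iu _ _]; rewrite /transition/= paramK.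
Qed.

Lemma msmooth_Ck (W : normedModType R) V (f : M -> W) k m :
  msmooth V f -> Ck m (coord k @` (V `&` dom k)) (f \o param k).
Proof. by move=> sf; exact: sf. Qed.

Lemma msmooth_diff (W : normedModType R) V (f : M -> W) k y :
  msmooth V f -> V y -> dom k y -> differentiable (f \o param k) (coord k y).
Proof.
by move=> sf Vy ky; have [d _] := msmooth_Ck k 1 sf; apply: d; exists y.
Qed.

Lemma mder_chart (W : normedModType R) (f : M -> W) k y v : dom k y ->
  differentiable (f \o param k) (coord k y) ->
  mder f y v = 'D_(ctrans (chart_at y) k y v) (f \o param k) (coord k y).
Proof. by move=> ky df; rewrite -derive_change_chart//; exact: dom_chart_at. Qed.

Definition chart_field (Y : M -> 'rV[R]_n) k := field_coord id Y k \o param k.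

Lemma chart_fieldE Y k y : dom k y ->
  chart_field Y k (coord k y) = ctrans (chart_at y) k y (Y y).
Proof. by move=> ky; rewrite /chart_field/= coordK. Qed.

Lemma chart_field_own Y y :
  chart_field Y (chart_at y) (coord (chart_at y) y) = Y y.
Proof. by rewrite chart_fieldE ?ctrans_id//; exact: dom_chart_at. Qed.

Lemma chart_field_diff Y V k y : smooth_field id V Y -> V y -> dom k y ->
  differentiable (chart_field Y k) (coord k y).
Proof. by move=> sY Vy ky; exact: (msmooth_diff (sY k) (conj Vy ky) ky). Qed.

Lemma chart_field_change Y k l y : dom k y -> dom l y ->
  chart_field Y l (coord l y) = ctrans k l y (chart_field Y k (coord k y)).
Proof.
by move=> ky ly; rewrite !chart_fieldE// ctrans_comp//; exact: dom_chart_at.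
Qed.

(** The Lie bracket in the components of the chart [k]. Neither term alone is a tangent vector. *)
Definition bracket (X Y : M -> 'rV[R]_n) k u :=
  'D_(chart_field X k u) (chart_field Y k) u - 'D_(chart_field Y k u) (chart_field X k) u.

Lemma derive_field_change Y V k l y w i : open V -> smooth_field id V Y ->
  V y -> dom k y -> dom l y ->
  'D_(ctrans k l y w) (chart_field Y l) (coord l y) 0 i =
  ctrans k l y ('D_w (chart_field Y k) (coord k y)) 0 i +
  'D_w ('D_(chart_field Y k (coord k y)) (fun u => transition k l u 0 i)) (coord k y).
Proof.
move=> oV sY Vy ky ly.
pose U := coord k @` (dom k `&` dom l).
have oU : open U by exact: open_transition_dom.
have Uy : U (coord k y) by exists y.
have cT : Ck 2 U (fun u => transition k l u 0 i).
  by apply: Ck_entry => //; exact: transition_smooth.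
have dY := chart_field_diff sY Vy ly.
rewrite -(derive_change_chart ky ly dY) -derive_entry; last first.
  exact: diff_change_chart ky ly dY.
have E : \forall u \near coord k y,
    'D_(chart_field Y k u) (fun u => transition k l u 0 i) u =
    (field_coord id Y l \o param k) u 0 i.
  have := near_param ky (dom_open l) ly; apply: filterS => u [iu lu ku].
  have -> : u = coord k (param k u) by rewrite paramK.
  rewrite derive_entry; last exact: transition_diff.
  rewrite -[LHS]/(ctrans _ _ _ _ 0 i) -chart_field_change// /chart_field /=.
  by rewrite !coordK.
rewrite -(near_eq_derive _ E).
have -> : ctrans k l y ('D_w (chart_field Y k) (coord k y)) 0 i =
  'D_('D_w (chart_field Y k) (coord k y)) (fun u => transition k l u 0 i) (coord k y).
  by rewrite derive_entry//; exact: transition_diff.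
apply: (derive_pairing (G := fun v u => 'D_v (fun u => transition k l u 0 i) u)).
- have : \forall u \near coord k y, U u by exact: open_nbhs_nbhs.
  apply: filterS => u Uu v; rewrite derive_sum_basis//.
  by have [d _] := cT; exact: d.
- by move=> v; have [_ /(_ v) [d _]] := cT; exact: d.
- by move=> j; apply: diff_entry; exact: chart_field_diff sY Vy ky.
- exact: chart_field_diff sY Vy ky.
Qed.

Lemma bracket_change X Y V k l y : open V -> smooth_field id V X ->
  smooth_field id V Y -> V y -> dom k y -> dom l y ->
  bracket X Y l (coord l y) = ctrans k l y (bracket X Y k (coord k y)).
Proof.
move=> oV sX sY Vy ky ly.
pose U := coord k @` (dom k `&` dom l).
have oU : open U by exact: open_transition_dom.
have Uy : U (coord k y) by exists y.
have -> : bracket X Y k (coord k y) =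
  (-1) *: 'D_(chart_field Y k (coord k y)) (chart_field X k) (coord k y) +
  'D_(chart_field X k (coord k y)) (chart_field Y k) (coord k y).
  by rewrite scaleN1r addrC.
rewrite ctrans_linear// /bracket; apply/rowP => i; rewrite !mxE.
rewrite !(chart_field_change _ ky ly).
have E1 := derive_field_change (chart_field X k (coord k y)) i oV sY Vy ky ly.
have E2 := derive_field_change (chart_field Y k (coord k y)) i oV sX Vy ky ly.
apply: etrans (congr2 (fun a b => a - b) E1 E2) _.
have cT : Ck 2 U (fun u => transition k l u 0 i).
  by apply: Ck_entry => //; exact: transition_smooth.
(* Symmetry makes the two second-order terms, one from each half of the bracket, equal. *)
have E3 := schwarz oU cT (chart_field X k (coord k y)) (chart_field Y k (coord k y)) Uy.
apply: etrans (congr1 (fun a => _ + a - _) E3) _.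
have cancel (a b d : R) : a + b - (d + b) = - 1 * d + a by ring.
exact: cancel.
Qed.

End Charts.

(** * Metrics and the Koszul formula *)

Section Metric.
Variables (R : realType) (n : nat) (M : orientedManifold R n) (g : M -> 'M[R]_n).
Hypothesis hg : is_metric g.
Implicit Types (k l : chart M) (x y : M).

Lemma innerDl (h : 'M[R]_n) a v w z :
  inner h (a *: v + w) z = a * inner h v z + inner h w z.
Proof. by rewrite /inner !mulmxDl -!scalemxAl !mxE. Qed.

Lemma innerC y v w : inner (g y) v w = inner (g y) w v.
Proof.
have [sg _ _] := hg.
by rewrite /inner -[in LHS](trmxK (v *m _ *m _)) mxE !trmx_mul trmxK sg mulmxA.
Qed.

Lemma inner_suml (h : 'M[R]_n) (I : finType) (a : I -> R) (v : I -> 'rV[R]_n) w :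
  inner h (\sum_i a i *: v i) w = \sum_i a i * inner h (v i) w.
Proof.
rewrite /inner !mulmx_suml summxE; apply: eq_bigr => i _.
by rewrite -!scalemxAl mxE.
Qed.

Lemma innerBr y v w z : inner (g y) z (v - w) = inner (g y) z v - inner (g y) z w.
Proof. by rewrite innerC -[w in LHS]scale1r -scaleNr addrC innerDl mulN1r addrC !(innerC _ z). Qed.

Lemma inner_delta (h : 'M[R]_n) i j : inner h 'e_i 'e_j = h i j.
Proof.
by rewrite /inner -rowE trmx_delta -colE !mxE.
Qed.

Lemma metric_unit y : g y \in unitmx.
Proof.
have [_ pg _] := hg; rewrite -row_free_unit; apply: inj_row_free => v vg.
apply/eqP; apply: contraT => /pg - /(_ y).
by rewrite /inner vg mul0mx mxE ltxx.
Qed.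

Lemma chart_metricE k y v w : dom k y -> chart_metric g k v w (coord k y) =
  inner (g y) (ctrans k (chart_at y) y v) (ctrans k (chart_at y) y w).
Proof. by move=> ky; rewrite /chart_metric /chart_vec coordK. Qed.

Lemma chart_metric_own y v w :
  chart_metric g (chart_at y) v w (coord (chart_at y) y) = inner (g y) v w.
Proof. by rewrite chart_metricE ?ctrans_id//; exact: dom_chart_at. Qed.

Lemma chart_metric_ctrans k y v w : dom k y ->
  chart_metric g k (ctrans (chart_at y) k y v) (ctrans (chart_at y) k y w) (coord k y)
  = inner (g y) v w.
Proof.
by move=> ky; rewrite chart_metricE// !ctrans_comp ?ctrans_id//; exact: dom_chart_at.
Qed.

Lemma chart_metric_sum k u v w : (coord k @` dom k) u ->
  chart_metric g k v w u = \sum_i v 0 i * chart_metric g k 'e_i w u.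
Proof.
move=> [y ky <-]; have kl := dom_chart_at y; rewrite chart_metricE//.
rewrite /ctrans derive_sum_basis; last exact: transition_diff.
rewrite inner_suml; apply: eq_bigr => i _.
by rewrite chart_metricE.
Qed.

Lemma chart_metricC k u v w : (coord k @` dom k) u ->
  chart_metric g k v w u = chart_metric g k w v u.
Proof. by move=> [y ky <-]; rewrite !(chart_metricE _ _ ky); exact: innerC. Qed.

Lemma chart_metric_diff k u v w : (coord k @` dom k) u ->
  differentiable (chart_metric g k v w) u.
Proof. by move=> ku; have [_ _ /(_ k v w 1) [d _]] := hg; exact: d. Qed.

Lemma near_chart_metric_sum k u w : (coord k @` dom k) u ->
  \forall u \near u, forall v,
  chart_metric g k v w u = \sum_i v 0 i * chart_metric g k 'e_i w u.
Proof.
move=> ku; have : nbhs u (coord k @` dom k).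
  by apply: open_nbhs_nbhs; split=> //; exact: image_open.
by apply: filterS => z kz v; exact: chart_metric_sum.
Qed.

Lemma derive_chart_metric_sum k u v w z : (coord k @` dom k) u ->
  'D_w (chart_metric g k v z) u = \sum_i v 0 i * 'D_w (chart_metric g k 'e_i z) u.
Proof.
move=> ku.
have E : \forall y \near u,
    (\sum_i (v 0 i *: chart_metric g k 'e_i z)) y = chart_metric g k v z y.
  by have := near_chart_metric_sum z ku; apply: filterS => y ->; rewrite fct_sumE.
have d i : derivable (chart_metric g k 'e_i z) u w.
  exact/diff_derivable/chart_metric_diff.
apply: etrans (esym (near_eq_derive w E)) _.
rewrite derive_sum; last by move=> i; exact: derivableZ.
by apply: eq_bigr => i _; exact: deriveZ.
Qed.

Lemma derive_chart_metricC k u v w z : (coord k @` dom k) u ->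
  'D_w (chart_metric g k v z) u = 'D_w (chart_metric g k z v) u.
Proof.
move=> ku; apply: near_eq_derive; have : nbhs u (coord k @` dom k).
  by apply: open_nbhs_nbhs; split=> //; exact: image_open.
by apply: filterS => y ky; exact: chart_metricC.
Qed.

Lemma derive_chart_metric_sumr k u v w z : (coord k @` dom k) u ->
  'D_w (chart_metric g k v z) u = \sum_i z 0 i * 'D_w (chart_metric g k v 'e_i) u.
Proof.
move=> ku; apply: etrans (derive_chart_metricC v w z ku) _.
apply: etrans (derive_chart_metric_sum z w v ku) _.
apply: eq_bigr => i _.
exact: (congr1 (fun t => z 0 i * t) (derive_chart_metricC 'e_i w v ku)).
Qed.

#[local] Opaque derive chart_metric.

Section PairFields.
Variables (k : chart M) (u : 'rV[R]_n) (X Y : 'rV[R]_n -> 'rV[R]_n).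
Hypotheses (ku : (coord k @` dom k) u)
  (dX : forall i, differentiable (fun z => X z 0 i) u)
  (dY : forall i, differentiable (fun z => Y z 0 i) u).

Let dXv v : differentiable (fun z => chart_metric g k (X z) v z) u.
Proof.
apply: (diff_pairing (G := fun v' z => chart_metric g k v' v z)) => //.
- exact: near_chart_metric_sum.
- by move=> v'; exact: chart_metric_diff.
Qed.

Let near_sum : \forall z \near u, forall v, chart_metric g k (X z) v z =
  \sum_i v 0 i * chart_metric g k (X z) 'e_i z.
Proof.
have : nbhs u (coord k @` dom k).
  by apply: open_nbhs_nbhs; split=> //; exact: image_open.
apply: filterS => z kz v; apply: etrans (chart_metricC _ _ kz) _.
apply: etrans (chart_metric_sum _ _ kz) _.
by apply: eq_bigr => i _; rewrite (chart_metricC 'e_i (X z) kz).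
Qed.

Lemma diff_chart_metric_fields :
  differentiable (fun z => chart_metric g k (X z) (Y z) z) u.
Proof.
exact: (@diff_pairing _ _ _ (fun v z => chart_metric g k (X z) v z) Y u near_sum dXv dY).
Qed.

Lemma derive_chart_metric_fields w : differentiable X u -> differentiable Y u ->
  'D_w (fun z => chart_metric g k (X z) (Y z) z) u =
  chart_metric g k ('D_w X u) (Y u) u + chart_metric g k (X u) ('D_w Y u) u
  + 'D_w (chart_metric g k (X u) (Y u)) u.
Proof.
move=> dXu dYu.
apply: etrans (@derive_pairing _ _ _ (fun v z => chart_metric g k (X z) v z)
  Y u near_sum dXv dY w dYu) _.
have dk v' : differentiable (chart_metric g k v' (Y u)) u by exact: chart_metric_diff.
have E := @derive_pairing _ _ _ (fun v z => chart_metric g k v (Y u) z)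
  X u (near_chart_metric_sum (Y u) ku) dk dX w dXu.
apply: etrans (congr1 (fun t => _ + t) E) _.
have ac (a b d : R) : a + (b + d) = b + a + d by rewrite addrCA addrA.
exact: ac.
Qed.

End PairFields.

(** In the preferred chart of [y] the Gram matrix is [g y] itself, so pairing with [z] cancels the
    inverse matrix in [christoffel]. What remains are Christoffel symbols of the first kind,
    extended linearly from basis vectors to [z]. *)
Lemma inner_covd Y y v z :
  let l := chart_at y in let u := coord l y in
  inner (g y) (covd g id Y y v) z =
  inner (g y) ('D_v (chart_field Y l) u) z
  + 2^-1 * ('D_v (chart_metric g l (Y y) z) u + 'D_(Y y) (chart_metric g l v z) u
            - 'D_z (chart_metric g l v (Y y)) u).
Proof.
move=> l u; have ly := dom_chart_at y.
have lu : (coord l @` dom l) u by exists y.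
rewrite /covd /= -/l -/u.
have -> : tmap id y v = v by exact: (ctrans_id v ly).
have -> : mder (field_coord id Y l) y v = 'D_v (chart_field Y l) u by [].
rewrite /christoffel addrC innerDl addrC; congr (_ + _ * _).
have -> : chart_gram g l u = g y.
  by apply/matrixP => i j; rewrite mxE chart_metric_own inner_delta.
rewrite /inner -(mulmxA _ (invmx _)) mulVmx ?metric_unit// mulmx1 mxE.
have F1 := derive_chart_metric_sumr (Y y) v z lu.
have F2 := derive_chart_metric_sumr v (Y y) z lu.
have F3 := derive_sum_basis z (chart_metric_diff v (Y y) lu).
apply: etrans _ (esym (congr2 (fun a b => a - b) (congr2 (fun a b => a + b) F1 F2) F3)).
rewrite -big_split -sumrB; apply: eq_bigr => i _.
rewrite !mxE mulrC.
exact: etrans (mulrBr _ _ _) (congr1 (fun a => a - _) (mulrDr _ _ _)).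
Qed.

End Metric.

#[local] Opaque derive chart_metric.

Section Koszul.
Variables (R : realType) (n : nat) (M : orientedManifold R n) (g : M -> 'M[R]_n).
Hypothesis hg : is_metric g.
Implicit Types (k l : chart M) (x y : M).
Variables (V : set M) (X Y : M -> 'rV[R]_n).
Hypotheses (oV : open V) (sX : smooth_field id V X) (sY : smooth_field id V Y).
Hypotheses (XX : forall y, V y -> inner (g y) (X y) (X y) = 1)
  (YY : forall y, V y -> inner (g y) (Y y) (Y y) = 1)
  (XY : forall y, V y -> inner (g y) (X y) (Y y) = 0).

(** The derivative along [w] of the constant function g(Z, W), split into the contributions of the
    two fields and of the metric coefficients. *)
Let metric_derivative (Z W : M -> 'rV[R]_n) c y w :
  smooth_field id V Z -> smooth_field id V W ->
  (forall y, V y -> inner (g y) (Z y) (W y) = c) -> V y ->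
  let l := chart_at y in let u := coord l y in
  inner (g y) ('D_w (chart_field Z l) u) (W y) + inner (g y) (Z y) ('D_w (chart_field W l) u)
  + 'D_w (chart_metric g l (Z y) (W y)) u = 0.
Proof.
move=> sZ sW ZW Vy l u; have ly := dom_chart_at y.
have lu : (coord l @` dom l) u by exists y.
have dZ := chart_field_diff sZ Vy ly; have dW := chart_field_diff sW Vy ly.
have := derive_chart_metric_fields hg lu (fun i => diff_entry i dZ) (fun i => diff_entry i dW) w dZ dW.
rewrite !chart_field_own !chart_metric_own => <-.
rewrite -[RHS](derive_cst c u w); apply: near_eq_derive.
have := near_param ly oV Vy; apply: filterS => z [iz Vz lz].
by rewrite -[z](paramK iz) !chart_fieldE// chart_metric_ctrans ?paramK// ZW.
Qed.

(** Constancy of g(X, Y) along [X] and of g(X, X) along [Y] trades the derivatives of the metric in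
    [inner_covd] for derivatives of the fields, which combine into the bracket. *)
Lemma koszul_first y : V y ->
  inner (g y) (covd g id X y (X y)) (Y y) =
  - inner (g y) (X y) (bracket X Y (chart_at y) (coord (chart_at y) y)).
Proof.
have alg (a b c d e f : R) : a + b + c = 0 -> d + e + f = 0 -> d = e ->
  a + 2^-1 * (c + c - f) = - (b - e) by lra.
move=> Vy; rewrite (inner_covd hg) /= /bracket !chart_field_own (innerBr hg).
have E1 := metric_derivative (X y) sX sY XY Vy.
have E2 := metric_derivative (Y y) sX sX XX Vy.
have E3 := innerC hg y ('D_(Y y) (chart_field X (chart_at y)) (coord (chart_at y) y)) (X y).
exact: alg E1 E2 E3.
Qed.

(** The two derivatives of g(X, Y) along [Y] cancel in [inner_covd]; the remaining derivative of the
    metric along [X] is converted by the constancy of g(Y, Y). *)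
Lemma koszul_second y : V y ->
  inner (g y) (covd g id X y (Y y)) (Y y) =
  - inner (g y) (Y y) (bracket X Y (chart_at y) (coord (chart_at y) y)).
Proof.
have alg (a b c d e f h : R) : e + f + c = 0 -> b = d -> e = f -> a = h ->
  a + 2^-1 * (b + c - d) = - (f - h) by lra.
move=> Vy; rewrite (inner_covd hg) /= /bracket !chart_field_own (innerBr hg).
have lu : (coord (chart_at y) @` dom (chart_at y)) (coord (chart_at y) y).
  by exists y => //; exact: dom_chart_at.
have E1 := metric_derivative (X y) sY sY YY Vy.
have E2 := derive_chart_metricC hg (X y) (Y y) (Y y) lu.
have E3 := innerC hg y ('D_(X y) (chart_field Y (chart_at y)) (coord (chart_at y) y)) (Y y).
have E4 := innerC hg y ('D_(Y y) (chart_field X (chart_at y)) (coord (chart_at y) y)) (Y y).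
exact: alg E1 E2 E3 E4.
Qed.

Let diff_bracket_entry k x i : V x -> dom k x ->
  differentiable (fun u => bracket X Y k u 0 i) (coord k x).
Proof.
move=> Vx kx; pose U := coord k @` (V `&` dom k).
have oU : open U by exact: open_coord_image.
have Ux : U (coord k x) by exists x.
have nU : nbhs (coord k x) U by exact: open_nbhs_nbhs.
have H Z W : smooth_field id V Z -> smooth_field id V W ->
    differentiable (fun u => 'D_(chart_field Z k u) (chart_field W k) u 0 i) (coord k x).
  move=> sZ sW.
  have eU : U = coord k @` ((V `&` id @^-1` dom k) `&` dom k).
    by congr image; rewrite -setIA setIid.
  have cW : Ck 2 U (chart_field W k) by rewrite eU; exact: (sW k k 2).
  have cWi := Ck_entry i oU cW.
  have dZ : forall j, differentiable (fun u => chart_field Z k u 0 j) (coord k x).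
    by move=> j; apply: diff_entry; exact: chart_field_diff sZ Vx kx.
  have near_lin : \forall u \near coord k x, forall v,
      'D_v (fun u => chart_field W k u 0 i) u =
      \sum_j v 0 j * 'D_('e_j) (fun u => chart_field W k u 0 i) u.
    by move: nU; apply: filterS => u Uu v; apply: derive_sum_basis; exact: (cWi.1).
  have dD v : differentiable ('D_v (fun u => chart_field W k u 0 i)) (coord k x).
    by have [_ /(_ v) [d _]] := cWi; exact: d.
  have := diff_pairing (G := fun v => 'D_v (fun u => chart_field W k u 0 i)) near_lin dD dZ.
  apply: near_eq_diff; move: nU; apply: filterS => u Uu.
  by apply: derive_entry; exact: (cW.1).
have -> : (fun u => bracket X Y k u 0 i) =
    (fun u => 'D_(chart_field X k u) (chart_field Y k) u 0 i) -
    (fun u => 'D_(chart_field Y k u) (chart_field X k) u 0 i).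
  by apply/funext => u; rewrite /bracket !mxE.
exact: differentiableB (H _ _ sX sY) (H _ _ sY sX).
Qed.

Let diff_inner_bracket (Z : M -> 'rV[R]_n) k x : smooth_field id V Z -> V x -> dom k x ->
  differentiable ((fun y => - inner (g y) (Z y)
    (bracket X Y (chart_at y) (coord (chart_at y) y))) \o param k) (coord k x).
Proof.
move=> sZ Vx kx.
have ku : (coord k @` dom k) (coord k x) by exists x.
have dZ j : differentiable (fun u => chart_field Z k u 0 j) (coord k x).
  by apply: diff_entry; exact: chart_field_diff sZ Vx kx.
have := differentiableN (diff_chart_metric_fields hg ku dZ (fun i => diff_bracket_entry i Vx kx)).
apply: near_eq_diff.
have := near_param kx oV Vx; apply: filterS => u [iu Vu lu].
rewrite !fctE /=; congr (- _).
rewrite -{1 2 3}[u](paramK iu) chart_fieldE//.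
rewrite (bracket_change oV sX sY Vu (dom_chart_at _) lu).
exact: chart_metric_ctrans.
Qed.

Lemma diff_connection_first k x : V x -> dom k x ->
  differentiable ((fun y => inner (g y) (covd g id X y (X y)) (Y y)) \o param k) (coord k x).
Proof.
move=> Vx kx; apply: near_eq_diff (diff_inner_bracket sX Vx kx).
have := near_param kx oV Vx; apply: filterS => u [iu Vu lu].
by rewrite /= koszul_first.
Qed.

Lemma diff_connection_second k x : V x -> dom k x ->
  differentiable ((fun y => inner (g y) (covd g id X y (Y y)) (Y y)) \o param k) (coord k x).
Proof.
move=> Vx kx; apply: near_eq_diff (diff_inner_bracket sY Vx kx).
have := near_param kx oV Vx; apply: filterS => u [iu Vu lu].
by rewrite /= koszul_second.
Qed.

End Koszul.

(** * The Dirac operator *)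

Section ComplexDifferentials.
Variables (R : realType) (n : nat) (M : orientedManifold R n).
Implicit Types (f h : M -> R[i]) (x y : M) (v : 'rV[R]_n).

Definition rdiff (r : M -> R) x :=
  differentiable (r \o param (chart_at x)) (coord (chart_at x) x).

Definition cdiff f x := rdiff (fun y => complex.Re (f y)) x /\
                        rdiff (fun y => complex.Im (f y)) x.

Lemma near_own_chart (W : Type) (f h : M -> W) V x : open V -> V x ->
  (forall y, V y -> f y = h y) ->
  \forall u \near coord (chart_at x) x, (f \o param (chart_at x)) u = (h \o param (chart_at x)) u.
Proof.
move=> oV Vx fh; have := near_param (dom_chart_at x) oV Vx.
by apply: filterS => u [_ Vu _]; exact: fh.
Qed.

Lemma mder_eq (f h : M -> R) V x v : open V -> V x ->
  (forall y, V y -> f y = h y) -> mder f x v = mder h x v.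
Proof. by move=> oV Vx fh; apply: near_eq_derive; exact: near_own_chart fh. Qed.

Lemma cder_eq f h V x v : open V -> V x ->
  (forall y, V y -> f y = h y) -> cder f x v = cder h x v.
Proof.
move=> oV Vx fh; rewrite /cder.
rewrite (@mder_eq (fun y => complex.Re (f y)) (fun y => complex.Re (h y)) V)//; last by move=> y /fh ->.
by rewrite (@mder_eq (fun y => complex.Im (f y)) (fun y => complex.Im (h y)) V)// => y /fh ->.
Qed.

Lemma csmooth_cdiff V f x : csmooth V f -> V x -> cdiff f x.
Proof.
move=> [sr si] Vx; have xx := dom_chart_at x.
by split; [exact: (msmooth_diff sr)|exact: (msmooth_diff si)].
Qed.

Lemma cdiff_cst (c : R[i]) x : cdiff (fun=> c) x.
Proof. by split; exact: differentiable_cst. Qed.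

Lemma cder_cst (c : R[i]) x v : cder (fun=> c) x v = 0.
Proof. by rewrite /cder /mder !derive_cst. Qed.

Lemma cdiff_real (r : M -> R) x : rdiff r x -> cdiff (fun y => (r y)%:C) x.
Proof. by move=> dr; split => //; exact: differentiable_cst. Qed.

Lemma cder_real (r : M -> R) x v : cder (fun y => (r y)%:C) x v = (mder r x v)%:C.
Proof. by rewrite /cder /mder/= derive_cst. Qed.

Lemma Re_add (a b : R[i]) : complex.Re (a + b) = complex.Re a + complex.Re b.
Proof. by case: a; case: b. Qed.

Lemma Im_add (a b : R[i]) : complex.Im (a + b) = complex.Im a + complex.Im b.
Proof. by case: a; case: b. Qed.

Lemma Re_mul (a b : R[i]) :
  complex.Re (a * b) = complex.Re a * complex.Re b - complex.Im a * complex.Im b.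
Proof. by case: a; case: b. Qed.

Lemma Im_mul (a b : R[i]) :
  complex.Im (a * b) = complex.Re a * complex.Im b + complex.Im a * complex.Re b.
Proof. by case: a; case: b. Qed.

Lemma rdiffD (r s : M -> R) x : rdiff r x -> rdiff s x -> rdiff (fun y => r y + s y) x.
Proof. exact: differentiableD. Qed.

Lemma rdiffN (r : M -> R) x : rdiff r x -> rdiff (fun y => - r y) x.
Proof. exact: differentiableN. Qed.

Lemma rdiffM (r s : M -> R) x : rdiff r x -> rdiff s x -> rdiff (fun y => r y * s y) x.
Proof. exact: differentiableM. Qed.

Lemma mderD (r s : M -> R) x v : rdiff r x -> rdiff s x ->
  mder (fun y => r y + s y) x v = mder r x v + mder s x v.
Proof. by move=> dr ds; apply: deriveD; exact: diff_derivable. Qed.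

Lemma mderN (r : M -> R) x v : rdiff r x -> mder (fun y => - r y) x v = - mder r x v.
Proof. by move=> dr; apply: deriveN; exact: diff_derivable. Qed.

Lemma mderM (r s : M -> R) x v : rdiff r x -> rdiff s x ->
  mder (fun y => r y * s y) x v = r x * mder s x v + s x * mder r x v.
Proof.
move=> dr ds.
apply: etrans (deriveM (diff_derivable (v := v) dr) (diff_derivable (v := v) ds)) _.
by rewrite /= coordK//; exact: dom_chart_at.
Qed.

Lemma cdiffD f h x : cdiff f x -> cdiff h x -> cdiff (fun y => f y + h y) x.
Proof.
move=> [fr fi] [hr hi]; split.
- rewrite (_ : (fun y => _) = (fun y => complex.Re (f y) + complex.Re (h y))).
    exact: rdiffD.
  by apply/funext => y; rewrite Re_add.
- rewrite (_ : (fun y => _) = (fun y => complex.Im (f y) + complex.Im (h y))).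
    exact: rdiffD.
  by apply/funext => y; rewrite Im_add.
Qed.

Lemma cderD f h x v : cdiff f x -> cdiff h x ->
  cder (fun y => f y + h y) x v = cder f x v + cder h x v.
Proof.
move=> [fr fi] [hr hi]; rewrite /cder.
rewrite (_ : (fun y => _) = (fun y => complex.Re (f y) + complex.Re (h y))); last first.
  by apply/funext => y; rewrite Re_add.
rewrite (_ : (fun y => complex.Im _) = (fun y => complex.Im (f y) + complex.Im (h y))).
  by rewrite !mderD.
by apply/funext => y; rewrite Im_add.
Qed.

Lemma cdiffM f h x : cdiff f x -> cdiff h x -> cdiff (fun y => f y * h y) x.
Proof.
move=> [fr fi] [hr hi]; split.
- rewrite (_ : (fun y => _) = (fun y => complex.Re (f y) * complex.Re (h y)
      + - (complex.Im (f y) * complex.Im (h y)))).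
    by apply: rdiffD; [exact: rdiffM|apply: rdiffN; exact: rdiffM].
  by apply/funext => y; rewrite Re_mul.
- rewrite (_ : (fun y => _) = (fun y => complex.Re (f y) * complex.Im (h y)
      + complex.Im (f y) * complex.Re (h y))).
    by apply: rdiffD; exact: rdiffM.
  by apply/funext => y; rewrite Im_mul.
Qed.

Lemma cderM f h x v : cdiff f x -> cdiff h x ->
  cder (fun y => f y * h y) x v = cder f x v * h x + f x * cder h x v.
Proof.
move=> [fr fi] [hr hi].
rewrite {1}/cder (_ : (fun y => _) = (fun y => complex.Re (f y) * complex.Re (h y)
      + - (complex.Im (f y) * complex.Im (h y)))); last first.
  by apply/funext => y; rewrite Re_mul.
rewrite (_ : (fun y => complex.Im _) = (fun y => complex.Re (f y) * complex.Im (h y)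
      + complex.Im (f y) * complex.Re (h y))); last first.
  by apply/funext => y; rewrite Im_mul.
have rr := rdiffM fr hr; have ii := rdiffM fi hi.
have ri := rdiffM fr hi; have ir := rdiffM fi hr.
rewrite (mderD v rr (rdiffN ii)) (mderN v ii) (mderD v ri ir) !mderM//.
apply/eqP; rewrite eq_complex Re_add Im_add !Re_mul !Im_mul /cder /=.
move: (mder _ _ _) (mder _ _ _) (mder _ _ _) (mder _ _ _) => a b c d; clear.
by apply/andP; split; apply/eqP; ring.
Qed.

Lemma cder_basis f x v : cdiff f x ->
  cder f x v = \sum_j (v 0 j)%:C * cder f x 'e_j.
Proof.
move=> [fr fi]; rewrite /cder /mder.
rewrite (derive_sum_basis v fr) (derive_sum_basis v fi).
apply/eqP; rewrite eq_complex (big_morph (@complex.Re R) Re_add erefl) (big_morph (@complex.Im R) Im_add erefl) /=.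
by apply/andP; split; apply/eqP; apply: eq_bigr => j _; rewrite ?mul0r ?subr0 ?addr0.
Qed.

(** [mder] at [y] uses the preferred chart of [y], which need not vary continuously. Moved to the
    fixed chart of [x], the function is the derivative of [r] along [chart_field Y k], a pairing
    with differentiable ingredients. *)
Lemma rdiff_mder V V' (r : M -> R) (Y : M -> 'rV[R]_n) x :
  open V -> open V' -> V x -> V' x ->
  msmooth V r -> smooth_field id V' Y -> rdiff (fun y => mder r y (Y y)) x.
Proof.
move=> oV oV' Vx V'x sr sY; have kx := dom_chart_at x.
pose k := chart_at x; pose U := coord k @` (V `&` dom k).
have oU : open U by exact: open_coord_image.
have Ux : U (coord k x) by exists x.
have nU : nbhs (coord k x) U by exact: open_nbhs_nbhs.
have c2 : Ck 2 U (r \o param k) := sr k 2.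
have dY j : differentiable (fun u => chart_field Y k u 0 j) (coord k x).
  by apply: diff_entry; exact: chart_field_diff sY V'x kx.
have near_lin : \forall u \near coord k x, forall v,
    'D_v (r \o param k) u = \sum_j v 0 j * 'D_('e_j) (r \o param k) u.
  by move: nU; apply: filterS => u Uu v; apply: derive_sum_basis; exact: (c2.1).
have dD v : differentiable ('D_v (r \o param k)) (coord k x).
  by have [_ /(_ v) [d _]] := c2; exact: d.
have := diff_pairing (G := fun v => 'D_v (r \o param k)) near_lin dD dY.
apply: near_eq_diff; have := near_param kx oV Vx.
apply: filterS => u [iu Vu ku] /=.
have dr : differentiable (r \o param k) (coord k (param k u)).
  by rewrite paramK//; apply: (c2.1); exists (param k u) => //; rewrite paramK.
rewrite (mder_chart (Y (param k u)) ku dr) /chart_field.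
rewrite -(chart_fieldE Y ku) /chart_field /=.
by rewrite (paramK iu).
Qed.

Lemma cdiff_cder V V' f (Y : M -> 'rV[R]_n) x :
  open V -> open V' -> V x -> V' x ->
  csmooth V f -> smooth_field id V' Y -> cdiff (fun y => cder f y (Y y)) x.
Proof.
move=> oV oV' Vx V'x [sr si] sY.
by split; [exact: rdiff_mder sr sY|exact: rdiff_mder si sY].
Qed.

End ComplexDifferentials.

(** * The Dirac operator in a trivialization and the expanded product *)

Section Dirac.
Variables (R : realType) (M : orientedManifold R 2) (g : M -> 'M[R]_2).
Hypothesis hg : is_metric g.
Variable S : spinStructure g.
Implicit Types (psi : spinor S) (al : trivn S) (x y : M) (f : M -> R[i]).

Lemma ord2P (k : 'I_2) : k = 0 \/ k = 1.
Proof. by case: k => [[|[|k]] Hk] //; [left|right]; apply/val_inj. Qed.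

Lemma sum_ord2 (T : nmodType) (F : 'I_2 -> T) : \sum_k F k = F 0 + F 1.
Proof. by rewrite big_ord_recl big_ord1; congr (_ + F _); exact/val_inj. Qed.

Lemma frame_inner al y i j : trivdom al y ->
  inner (g y) (row i (frame al y)) (row j (frame al y)) = (i == j)%:R.
Proof.
move=> /(@frame_on _ _ _ S) [E _].
have -> : (i == j)%:R = (frame al y *m g y *m (frame al y)^T) i j by rewrite E mxE.
rewrite /inner tr_row -!row_mul mxE [LHS]mxE [RHS]mxE.
by apply: eq_bigr => l _; congr (_ * _); rewrite !mxE.
Qed.

(** The connection form g(nabla e_1, e_2) on the frame vectors only: these two values are all that
    [dirac] uses, and the Koszul lemmas express exactly them by the bracket of the frame. *)
Definition connection al (k : 'I_2) y : R :=
  inner (g y) (covd g id (fun z => row 0 (frame al z)) y (row k (frame al y)))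
    (row 1 (frame al y)).

Lemma rdiff_connection al k x : trivdom al x -> rdiff (connection al k) x.
Proof.
move=> ax; have oV := @trivdom_open _ _ _ S al.
have s0 := @frame_smooth _ _ _ S al 0; have s1 := @frame_smooth _ _ _ S al 1.
have f00 y : trivdom al y -> inner (g y) (row 0 (frame al y)) (row 0 (frame al y)) = 1.
  by move=> ay; rewrite frame_inner.
have f11 y : trivdom al y -> inner (g y) (row 1 (frame al y)) (row 1 (frame al y)) = 1.
  by move=> ay; rewrite frame_inner.
have f01 y : trivdom al y -> inner (g y) (row 0 (frame al y)) (row 1 (frame al y)) = 0.
  by move=> ay; rewrite frame_inner.
have xx := dom_chart_at x.
have [->|->] := ord2P k.
- exact: (diff_connection_first hg oV s0 s1 f00 f01 ax xx).
- exact: (diff_connection_second hg oV s0 s1 f11 ax xx).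
Qed.

Definition sdiff psi al x := forall r, cdiff (fun y => psi al y r 0) x.

Definition sder psi al x v : 'cV[R[i]]_2 := \col_r cder (fun y => psi al y r 0) x v.

Lemma cdiff_sum (I : finType) (F : I -> M -> R[i]) x :
  (forall i, cdiff (F i) x) -> cdiff (fun y => \sum_i F i y) x.
Proof.
move=> dF; rewrite (_ : (fun y => _) = \sum_i F i); last first.
  by apply/funext => y; rewrite fct_sumE.
apply: (big_ind (fun f : M -> R[i] => cdiff f x)) => [|a b da db|i _]; last exact: dF.
- exact: cdiff_cst.
- exact: cdiffD.
Qed.

Lemma sdiff_mx (B : 'M[R[i]]_2) psi al x :
  sdiff psi al x -> sdiff (fun be y => B *m psi be y) al x.
Proof.
move=> dpsi r.
rewrite (_ : (fun y => _) = (fun y => \sum_s B r s * psi al y s 0)).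
  by apply: cdiff_sum => s; apply: cdiffM; [exact: cdiff_cst|exact: dpsi].
by apply/funext => y; rewrite mxE.
Qed.

Lemma sder_mx (B : 'M[R[i]]_2) psi al x v : sdiff psi al x ->
  sder (fun be y => B *m psi be y) al x v = B *m sder psi al x v.
Proof.
move=> dpsi; apply/matrixP => r s; rewrite !mxE !big_ord_recl big_ord0 addr0 !mxE.
rewrite (_ : (fun y => _) = (fun y => B r 0 * psi al y 0 0 + B r (lift 0 0) * psi al y (lift 0 0) 0)).
  have dc (z : R[i]) : cdiff (fun=> z) x by exact: cdiff_cst.
  rewrite cderD; [|exact: cdiffM|exact: cdiffM].
  by rewrite !cderM// !cder_cst !mul0r !add0r.
by apply/funext => y; rewrite mxE !big_ord_recl big_ord0 addr0.
Qed.

Lemma sdiffD psi phi al x : sdiff psi al x -> sdiff phi al x -> sdiff (psi + phi) al x.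
Proof.
move=> d1 d2 r; rewrite (_ : (fun y => _) = (fun y => psi al y r 0 + phi al y r 0)).
  exact: cdiffD.
by apply/funext => y; rewrite mxE.
Qed.

Lemma sderD psi phi al x v : sdiff psi al x -> sdiff phi al x ->
  sder (psi + phi) al x v = sder psi al x v + sder phi al x v.
Proof.
move=> d1 d2; apply/matrixP => r s; rewrite !mxE.
rewrite (_ : (fun y => _) = (fun y => psi al y r 0 + phi al y r 0)).
  by rewrite cderD.
by apply/funext => y; rewrite mxE.
Qed.

Lemma sdiff_fmul f psi al x : cdiff f x -> sdiff psi al x -> sdiff (fmul f psi) al x.
Proof.
move=> df d r; rewrite (_ : (fun y => _) = (fun y => f y * psi al y r 0)).
  exact: cdiffM.
by apply/funext => y; rewrite mxE.
Qed.

Lemma sder_fmul f psi al x v : cdiff f x -> sdiff psi al x ->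
  sder (fmul f psi) al x v = cder f x v *: psi al x + f x *: sder psi al x v.
Proof.
move=> df d; apply/matrixP => r s; rewrite (ord1 s) !mxE.
rewrite (_ : (fun y => _) = (fun y => f y * psi al y r 0)).
  by rewrite cderM.
by apply/funext => y; rewrite mxE.
Qed.

Lemma dirac_mx psi al x : dirac psi al x = \sum_k gamma_mx R k *m
  (sder psi al x (row k (frame al x)) + (connection al k x / 2)%:C *: (omega_mx R *m psi al x)).
Proof. by []. Qed.

Lemma dirac_add psi phi al x : sdiff psi al x -> sdiff phi al x ->
  dirac (psi + phi) al x = dirac psi al x + dirac phi al x.
Proof.
move=> d1 d2; rewrite !dirac_mx -big_split; apply: eq_bigr => k _ /=.
rewrite -mulmxDr sderD// -[(psi + phi) al x]/(psi al x + phi al x).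
by rewrite [omega_mx R *m (_ + _)]mulmxDr scalerDr addrACA.
Qed.

Lemma dirac_fmul f psi al x : cdiff f x -> sdiff psi al x ->
  dirac (fmul f psi) al x =
  \sum_k cder f x (row k (frame al x)) *: (gamma_mx R k *m psi al x) + f x *: dirac psi al x.
Proof.
move=> df d; rewrite !dirac_mx scaler_sumr -big_split; apply: eq_bigr => k _ /=.
rewrite sder_fmul// !scalemxAr -mulmxDr; congr (_ *m _).
by rewrite /fmul scalerDr addrA; congr (_ + _); rewrite -!scalemxAr !scalerA mulrC.
Qed.

Lemma gamma_omega (k : 'I_2) : gamma_mx R k *m omega_mx R = - (omega_mx R *m gamma_mx R k).
Proof.
have c10 : gamma_mx R 1 *m gamma_mx R 0 = - (gamma_mx R 0 *m gamma_mx R 1).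
  apply/eqP; rewrite -addr_eq0 gamma_clifford /= mulr0n mulr0 oppr0.
  by apply/eqP/matrixP => r s; rewrite !mxE mul0rn.
have [->|->] := ord2P k; rewrite /omega_mx.
- by rewrite -[in RHS]mulmxA c10 mulmxN opprK.
- by rewrite mulmxA c10 mulNmx.
Qed.

Lemma gamma_sq (k : 'I_2) : gamma_mx R k *m gamma_mx R k = - 1%:M.
Proof.
have := gamma_clifford R k k; rewrite eqxx mulr1 -mulr2n => E.
have n2 : (2%:R : R[i]) != 0 by rewrite pnatr_eq0.
apply: (scalerI n2); rewrite scaler_nat E scalerN.
by apply/matrixP => r s; rewrite !mxE mulrnAr mulr1 mulNrn.
Qed.

Lemma omega_sq : omega_mx R *m omega_mx R = - 1%:M.
Proof.
rewrite {2}/omega_mx mulmxA -[_ *m gamma_mx R 0]opprK -gamma_omega mulNmx.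
by rewrite /omega_mx mulmxA gamma_sq mulNmx mul1mx mulNmx opprK gamma_sq.
Qed.

(** [omega] is parallel: its matrix is constant and commutes with the connection term, a multiple of
    itself. The sign comes from [gamma_omega]. *)
Lemma dirac_omega psi al x : sdiff psi al x ->
  dirac (omega psi) al x = - (omega_mx R *m dirac psi al x).
Proof.
move=> d; rewrite !dirac_mx mulmx_sumr -sumrN; apply: eq_bigr => k _.
by rewrite sder_mx// /omega scalemxAr -mulmxDr mulmxA gamma_omega mulNmx -mulmxA.
Qed.

Lemma section_sdiff Om psi al x : is_section Om psi -> Om x -> trivdom al x ->
  sdiff psi al x.
Proof. by move=> [spsi _] Ox ax r; exact: (csmooth_cdiff (spsi al r)). Qed.

Lemma section_sdiff_dirac Om psi al x : open Om -> is_section Om psi -> Om x ->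
  trivdom al x -> sdiff (dirac psi) al x.
Proof.
move=> oO sec Ox ax r; have [spsi _] := sec.
have oa := @trivdom_open _ _ _ S al.
have oV : open (Om `&` trivdom al) by exact: openI.
rewrite (_ : (fun y => _) = (fun y => \sum_k \sum_s gamma_mx R k r s *
  (cder (fun y => psi al y s 0) y (row k (frame al y)) +
   (connection al k y / 2)%:C * (omega_mx R *m psi al y) s 0))); last first.
  apply/funext => y; rewrite dirac_mx summxE; apply: eq_bigr => k _.
  by rewrite mxE; apply: eq_bigr => s _; rewrite !mxE.
apply: cdiff_sum => k; apply: cdiff_sum => s; apply: cdiffM; first exact: cdiff_cst.
apply: cdiffD.
  exact: (cdiff_cder oV oa (conj Ox ax) ax (spsi al s) (@frame_smooth _ _ _ S al k)).
apply: cdiffM.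
  apply: cdiff_real; apply: rdiffM; first exact: rdiff_connection.
  exact: differentiable_cst.
by apply: sdiff_mx; exact: section_sdiff sec Ox ax.
Qed.

(** The terms in D^2 cancel. Moving the outer D past q omega produces -q omega D, and b q omega^2 =
    -b q; this fixes the signs of [q] in the first-order and scalar coefficients. *)
Lemma factor_product Om psi al x (c : R) (eta : R[i]) (A : M -> 'M[R]_2) (a b p q : M -> R[i]) :
  open Om -> is_section Om psi -> Om x -> trivdom al x -> csmooth Om p -> csmooth Om q ->
  (dirac_factor a b \o dirac_factor p q) psi al x - B_op c eta A psi al x =
  (a x + p x) *: dirac psi al x + (b x - q x - 2 * eta) *: (omega_mx R *m dirac psi al x)
  + (a x * p x - b x * q x
     - (shape_norm2 A x - mean_curvature A x ^+ 2 - 2 * c)%:C) *: psi al x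
  + (a x * q x + b x * p x + 2 * eta * (mean_curvature A x)%:C) *: (omega_mx R *m psi al x)
  + \sum_k cder p x (row k (frame al x)) *: (gamma_mx R k *m psi al x)
  + \sum_k cder q x (row k (frame al x)) *: (gamma_mx R k *m (omega_mx R *m psi al x)).
Proof.
move=> oO sec Ox ax sp sq.
have dpsi := section_sdiff sec Ox ax.
have dD := section_sdiff_dirac oO sec Ox ax.
have dp := csmooth_cdiff sp Ox; have dq := csmooth_cdiff sq Ox.
have dom : sdiff (omega psi) al x by exact: sdiff_mx.
have E : dirac (dirac_factor p q psi) al x = dirac (dirac psi) al x
   + (\sum_k cder p x (row k (frame al x)) *: (gamma_mx R k *m psi al x) + p x *: dirac psi al x)
   + (\sum_k cder q x (row k (frame al x)) *: (gamma_mx R k *m (omega_mx R *m psi al x))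
      - q x *: (omega_mx R *m dirac psi al x)).
  rewrite /dirac_factor dirac_add; last 2 first.
  - by apply: sdiffD => //; exact: sdiff_fmul.
  - exact: sdiff_fmul.
  rewrite dirac_add//; last exact: sdiff_fmul.
  by rewrite !dirac_fmul// dirac_omega// scalerN.
have F : (dirac_factor a b \o dirac_factor p q) psi al x = dirac (dirac_factor p q psi) al x +
  a x *: (dirac psi al x + p x *: psi al x + q x *: (omega_mx R *m psi al x)) +
  b x *: (omega_mx R *m (dirac psi al x + p x *: psi al x + q x *: (omega_mx R *m psi al x))).
  by [].
have B : B_op c eta A psi al x = dirac (dirac psi) al x
  + (2 * eta) *: (omega_mx R *m dirac psi al x)
  - (2 * eta * (mean_curvature A x)%:C) *: (omega_mx R *m psi al x)
  + (shape_norm2 A x - mean_curvature A x ^+ 2 - 2 * c)%:C *: psi al x by [].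
rewrite F E B.
rewrite !mulmxDr -!scalemxAr mulmxA omega_sq mulNmx mul1mx.
move: (\sum_k cder p x _ *: _) => S1; move: (\sum_k cder q x _ *: _) => S2.
move: (dirac (dirac psi) al x) (omega_mx R *m dirac psi al x) => DD WD.
move: (dirac psi al x) (omega_mx R *m psi al x) (psi al x) => D W P.
move: (_%:C) (_%:C) => m n; apply/matrixP => r s; rewrite !mxE; clear. ring.
Qed.

End Dirac.

(** * Bump sections *)

Section Paraboloid.
Variables (R : realType) (V : normedModType R) (n : nat) (r : R) (c : 'rV[R]_n).

(** Positive exactly where the squared Euclidean distance to [c] is less than [r], so [flat 0] of it
    is a bump. A sum of squares is taken because the norm of row vectors is a maximum and is not
    smooth in general. *)
Definition paraboloid (u : 'rV[R]_n) : R := r - \sum_i (u 0 i - c 0 i) ^+ 2.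

Variable T : V -> 'rV[R]_n.

Let factor i : V -> R := (fun y => T y 0 i) + cst (- c 0 i).

Let paraboloidE : paraboloid \o T = cst r + - \sum_i (factor i * factor i).
Proof.
apply/funext => y; rewrite /paraboloid /= !fctE; congr (_ - _).
by rewrite fct_sumE; apply: eq_bigr => i _; rewrite expr2.
Qed.

Lemma Ck_paraboloid k (U : set V) : open U -> Ck k U T -> Ck k U (paraboloid \o T).
Proof.
move=> oU cT; rewrite paraboloidE; apply: Ck_add => //; first exact: Ck_cst.
apply: Ck_opp => //; apply: Ck_sum => // i.
have cf : Ck k U (factor i) by apply: Ck_add => //; [exact: Ck_entry|exact: Ck_cst].
exact: Ck_mul.
Qed.

Lemma derive_paraboloid u v : differentiable T u ->
  'D_v (paraboloid \o T) u = - \sum_i (2 * (T u 0 i - c 0 i) * 'D_v T u 0 i).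
Proof.
move=> dT; rewrite paraboloidE.
have df i : derivable (factor i) u v.
  by apply: derivableD; [apply: diff_derivable; exact: diff_entry|exact: derivable_cst].
have dff i : derivable (factor i * factor i) u v by exact: derivableM.
have ds : derivable (\sum_i (factor i * factor i)) u v by exact: derivable_sum.
rewrite deriveD; [|exact: derivable_cst|exact: derivableN].
rewrite derive_cst add0r deriveN// derive_sum//; congr (- _); apply: eq_bigr => i _.
have E : 'D_v (factor i) u = 'D_v T u 0 i.
  rewrite deriveD; [|by apply: diff_derivable; exact: diff_entry|exact: derivable_cst].
  by rewrite derive_cst addr0 derive_entry.
apply: etrans (deriveM (df i) (df i)) _; rewrite E.
rewrite /factor !fctE /GRing.scale /=; move: (T u 0 i) ('D_v T u 0 i) => a b.
by clear; ring.
Qed.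

End Paraboloid.

Section Bump.
Variables (R : realType) (n : nat) (M : orientedManifold R n).
Variables (k : chart M) (V0 C : set M) (r : R) (c : 'rV[R]_n).
Hypotheses (oV0 : open V0) (clC : closed C) (CV0 : C `<=` V0 `&` dom k)
  (suppC : forall y, V0 y -> dom k y -> 0 < paraboloid r c (coord k y) -> C y).

(** [coord k] carries no meaning off [dom k], hence the explicit extension by zero. [V0] will be the
    domain of a spin trivialization, and [C] contains every point where the bump is nonzero. *)
Definition chart_bump (y : M) : R :=
  if y \in V0 `&` dom k then flat 0 (paraboloid r c (coord k y)) else 0.

Lemma chart_bump_in y : V0 y -> dom k y -> chart_bump y = flat 0 (paraboloid r c (coord k y)).
Proof. by move=> Vy ky; rewrite /chart_bump mem_set. Qed.

Lemma chart_bump_out y : ~ C y -> chart_bump y = 0.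
Proof.
move=> Cy; rewrite /chart_bump; case: ifPn => // /set_mem[Vy ky].
by rewrite flat_npos// leNgt; apply/negP => /(suppC Vy ky).
Qed.

Lemma msmooth_lin V (f h : M -> R) (a b : R) : open V -> msmooth V f -> msmooth V h ->
  msmooth V (fun y => a * f y + b * h y).
Proof.
move=> oV sf sh l m.
have oU := open_coord_image (k := l) oV.
exact: (Ck_add oU (Ck_mul oU (@Ck_cst R _ R^o m _ (a : R)) (sf l m))
          (Ck_mul oU (@Ck_cst R _ R^o m _ (b : R)) (sh l m))).
Qed.

(** Two open sets cover the manifold: [V0] meets [dom k] in one, where the explicit formula holds,
    and the complement of [C] is the other, where the product is 0. [f] is controlled only over [V0]
    because it will be built from a spin lift, which is arbitrary elsewhere. *)
Lemma msmooth_chart_bump V (f : M -> R) : open V -> msmooth (V `&` V0) f ->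
  msmooth V (fun y => chart_bump y * f y).
Proof.
move=> oV sf l m; apply: Ck_local => _ [y [Vy ly] <-].
have [[V0y ky]|nWy] := pselect ((V0 `&` dom k) y).
  pose W := V `&` V0 `&` dom k.
  have oW : open W by apply: openI; [exact: openI|exact: dom_open].
  have Wy : W y by [].
  exists (coord l @` (W `&` dom l)), ((flat 0 \o (paraboloid r c \o transition l k)) * (f \o param l)).
  have oU := open_coord_image (k := l) oW.
  split; first by exists y.
  - apply: Ck_mul => //.
      apply: Ck_flat => //; apply: Ck_paraboloid => //.
      apply: Ck_sub (transition_smooth l k m) => _ [z [Wz lz] <-].
      by exists z => //; split=> //; case: Wz.
    apply: Ck_sub (sf l m) => _ [z [Wz lz] <-].
    by exists z => //; split=> //; case: Wz.
  - have := near_param ly oW Wy; apply: filterS => u [iu [[Vu V0u] ku] lu].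
    by rewrite /= chart_bump_in.
exists setT, (cst 0); split => //; first exact: Ck_cst.
have nC : (~` C) y by move=> /CV0.
have oC : open (~` C) by exact: closed_openC.
have := near_param ly oC nC; apply: filterS => u [_ Cu _].
by rewrite /= chart_bump_out// mul0r.
Qed.

End Bump.

Section Localization.
Variables (R : realType) (n : nat) (M : orientedManifold R n).

(* [C] is closed in [M] and not only in [V] because [M] is Hausdorff. *)
Lemma closed_chart_cube (k : chart M) (V : set M) (x : M) (w : 'rV[R]_n) :
  open V -> V x -> dom k x ->
  exists (d r : R) (C : set M), let c := coord k x + d *: w in
  [/\ 0 < d, closed C, C `<=` V `&` dom k,
    forall y, V y -> dom k y -> 0 < paraboloid r c (coord k y) -> C y &
    0 < paraboloid r c (coord k x)].
Proof.
have sqr_lt (t a z : R) : 0 <= z -> (t - a) ^+ 2 < z ^+ 2 -> a - z <= t <= a + z.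
  by move=> z0 H; apply/andP; split; nra.
move=> oV Vx kx.
pose U := coord k @` (V `&` dom k).
have oU : open U by exact: open_coord_image.
have Ux : U (coord k x) by exists x.
have /nbhs_ballP[e /= e0 He] : nbhs (coord k x) U by exact: open_nbhs_nbhs.
(* [s] dominates each |w_i| as well as their sum, and the 1 allows w = 0. With d = e / (4 s) the
   displacement d w has all entries at most e / 4. *)
pose s := 1 + \sum_i `|w 0 i|.
have s1 : 1 <= s by rewrite /s lerDl sumr_ge0.
have s0 : 0 < s by lra.
have ws i : `|w 0 i| <= s.
  rewrite /s (bigD1 i)//= addrCA lerDl addr_ge0// sumr_ge0//.
pose d := e / 4 / s.
have d0 : 0 < d by rewrite !divr_gt0.
have ds : d * s = e / 4 by rewrite /d divfK// gt_eqF.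
pose c := coord k x + d *: w.
(* The centre is within e / 4 of [coord k x], so a cube of half-side e / 2 about it stays in the
   ball of radius [e]. On the other side, |d w|^2 <= (e / 4)^2 < (e / 2)^2 keeps the paraboloid
   positive at [x]. *)
pose rho := e / 2; pose r := rho ^+ 2.
pose K := [set u : 'rV[R]_n | forall i, `[c 0 i - rho, c 0 i + rho]%classic (u 0 i)].
have cK : compact K.
  by apply: (@rV_compact _ _ (fun i => `[c 0 i - rho, c 0 i + rho]%classic)) => i; exact: segment_compact.
have KU : K `<=` U.
  move=> u Ku; apply: He; split=> // i j; rewrite (ord1 i) /ball /=.
  have := Ku j; rewrite /= in_itv /= => /andP[u1 u2].
  have cj : c 0 j = coord k x 0 j + d * w 0 j by rewrite !mxE.
  have wj : `|d * w 0 j| <= e / 4.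
    by rewrite normrM gtr0_norm// -ds ler_pM2l.
  move: wj; rewrite ler_norml => /andP[w1 w2].
  by rewrite ltr_norml; apply/andP; split; rewrite /rho in u1 u2; lra.
exists d, r, (param k @` K); split => //.
- apply: compact_closed; first exact: carrier_hausdorff.
  apply: continuous_compact cK; apply: continuous_in_subspaceT => u /set_mem /KU [y [Vy ky] <-].
  by apply: param_continuous; exists y.
- by move=> _ [u /KU[y [Vy ky] <-] <-]; rewrite coordK.
- move=> y Vy ky Q0; exists (coord k y); last exact: coordK.
  move=> i; rewrite /= in_itv /=.
  have : (coord k y 0 i - c 0 i) ^+ 2 < rho ^+ 2.
    apply: le_lt_trans (_ : \sum_j (coord k y 0 j - c 0 j) ^+ 2 < _).
      by rewrite (bigD1 i)//= lerDl sumr_ge0// => j _; exact: sqr_ge0.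
    by rewrite -subr_gt0.
  have rho0 : 0 <= rho by rewrite /rho; lra.
  exact: sqr_lt.
- rewrite /paraboloid subr_gt0.
  have cE i : coord k x 0 i - (coord k x + d *: w) 0 i = - (d * w 0 i).
    by rewrite !mxE; ring.
  apply: (@le_lt_trans _ _ (\sum_i d * `|w 0 i| * (e / 4))).
    apply: ler_sum => i _; rewrite cE sqrrN.
    have -> : (d * w 0 i) ^+ 2 = (d * `|w 0 i|) * (d * `|w 0 i|).
      by rewrite -expr2 !exprMn real_normK ?num_real.
    have dw : 0 <= d * `|w 0 i| by rewrite mulr_ge0// ltW.
    by apply: ler_wpM2l => //; rewrite -ds ler_pM2l.
  rewrite -mulr_suml -mulr_sumr -ds.
  have sle : \sum_i `|w 0 i| <= s by rewrite /s lerDr.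
  have : d * (\sum_i `|w 0 i|) <= e / 4 by rewrite -ds ler_pM2l.
  rewrite /r /rho ds; move: (d * _) => t; clear -e0; nra.
Qed.

End Localization.

(** * Spinor fields with prescribed value and derivative at a point *)

Section TestSections.
Variables (R : realType) (M : orientedManifold R 2) (g : M -> 'M[R]_2).
Variable S : spinStructure g.
Implicit Types (al be : trivn S) (x y : M).

(** [omega_mx] squares to -1, so it plays the role of the imaginary unit. The cocycle of spin lifts
    thus becomes a cocycle of transition matrices. *)
Lemma spin_mxM (z1 z2 : R[i]) : spin_mx (z1 * z2) = spin_mx z1 *m spin_mx z2.
Proof.
rewrite /spin_mx Re_mul Im_mul mulmxDl !mulmxDr -!scalemxAl -!scalemxAr omega_sq.
rewrite !mul_scalar_mx !mul_mx_scalar !scalerA !scalerN.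
apply/matrixP => r s; rewrite !mxE rmorphB rmorphD !rmorphM /=.
by case: (r == s); rewrite ?mulr1n ?mulr0n; ring.
Qed.

Lemma spin_mx1 : spin_mx (1 : R[i]) = 1%:M.
Proof. by rewrite /spin_mx /= scale0r addr0. Qed.

(** The cocycle identity gives z z = z, and |z| = 1 excludes z = 0. *)
Lemma spin_lift_id al x : trivdom al x -> spin_lift al al x = 1.
Proof.
move=> ax; have z1 := spin_lift_norm ax ax.
have z0 : spin_lift al al x != 0 by rewrite -normr_gt0 z1 ltr01.
by apply: (mulfI z0); rewrite mulr1; exact: spin_lift_cocycle.
Qed.

(* [psi] is a bump centred at [x] shifted by a small multiple of [w]; [w = 0] is
   allowed and gives vanishing first derivatives. *)
Lemma test_section Om al x (j : 'I_2) (w : 'rV[R]_2) : open Om -> Om x -> trivdom al x ->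
  exists (psi : spinor S) (t kap : R), [/\ 0 < t, 0 < kap, is_section Om psi,
    psi al x = t%:C *: delta_mx j 0 &
    forall v, sder psi al x v = (kap * \sum_i w 0 i * v 0 i)%:C *: delta_mx j 0].
Proof.
move=> oO Ox ax; pose k := chart_at x; have kx : dom k x := dom_chart_at x.
have oa be : open (trivdom be) by exact: trivdom_open.
have [d [r [C [d0 clC CV suppC Qx]]]] := closed_chart_cube w (oa al) ax kx.
set c := coord k x + d *: w in suppC Qx.
pose h := chart_bump k (trivdom al) r c.
pose psi : spinor S := fun be y => (h y)%:C *: (spin_mx (spin_lift be al y) *m delta_mx j 0).
have psiE be y s : psi be y s 0 = (h y)%:C * spin_mx (spin_lift be al y) s j.
  by rewrite /psi -colE !mxE.
have oW : open (trivdom al `&` dom k) by apply: openI => //; exact: dom_open.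
have psi_al y (s : 'I_2) : trivdom al y -> psi al y s 0 = ((s == j)%:R * h y)%:C.
  by move=> ay; rewrite psiE spin_lift_id// spin_mx1 mxE rmorphM rmorph_nat mulrC.
have did (u : 'rV[R]_2) : differentiable (id : 'rV[R]_2 -> 'rV[R]_2) u.
  by apply: ex_diff.
have dQ u : differentiable (paraboloid r c) u.
  have cid : Ck 1 setT (id : 'rV[R]_2 -> 'rV[R]_2).
    split=> [y _|v]; first exact: did.
    apply: Ck_local => y _; exists setT, (cst v); split => //; first exact: Ck_cst.
    by near=> z; rewrite derive_id.
  by have [dp _] := Ck_paraboloid r c openT cid; exact: dp.
(* The centre being at x + d w in coordinates, the paraboloid has derivative 2 d w.v along [v] at
   [x]; the chain rule contributes [dflat 0], which equals [flat 2] and is positive there. *)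
exists psi, (h x), (2 * d * dflat 0 (paraboloid r c (coord k x))).
have hx : h x = flat 0 (paraboloid r c (coord k x)) by exact: chart_bump_in.
split.
- by rewrite hx; exact: flat_pos.
- by rewrite mulr_gt0 ?mulr_gt0// /dflat oppr0 mul0r add0r; exact: flat_pos.
- split=> [be s|be ga y Oy by_ gy].
    have [lr li] := @spin_lift_smooth _ _ _ S be al.
    have oV : open (Om `&` trivdom be) by exact: openI.
    have sub (f : M -> R) : msmooth (trivdom be `&` trivdom al) f ->
        msmooth (Om `&` trivdom be `&` trivdom al) f.
      move=> sf l m; apply: Ck_sub (sf l m) => _ [y [[[Oy b_y] ay] ly] <-].
      by exists y.
    have oVa : open (Om `&` trivdom be `&` trivdom al) by exact: openI.
    (* The real and imaginary parts of an entry of [spin_mx u] are real linear combinations of Re u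
       and Im u, so one statement covers all components. *)
    have sm a b := msmooth_chart_bump (oa al) clC CV suppC oV
      (msmooth_lin a b oVa (sub _ lr) (sub _ li)).
    split.
      rewrite (_ : (fun y => _) = (fun y => h y * ((s == j)%:R * complex.Re (spin_lift be al y)
        + complex.Re (omega_mx R s j) * complex.Im (spin_lift be al y)))); first exact: sm.
      apply/funext => y; rewrite psiE /spin_mx !mxE Re_mul Re_add Re_mul /= !mul0r !subr0.
      congr (_ * (_ + _)); last by rewrite mulrC.
      by case: (s == j); rewrite ?mulr1n ?mulr0n ?mul1r ?mul0r.
    rewrite (_ : (fun y => _) = (fun y => h y * (0 * complex.Re (spin_lift be al y)
        + complex.Im (omega_mx R s j) * complex.Im (spin_lift be al y)))); first exact: sm.
    apply/funext => y; rewrite psiE /spin_mx !mxE Im_mul Im_add Im_mul /= !mul0r !addr0.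
    congr (_ * (_ + _)); last by rewrite mulrC.
    by case: (s == j); rewrite ?mulr1n ?mulr0n.
  (* Off the domain of [al] the cocycle identity says nothing, but there the bump is zero and both
     sides vanish. *)
  have [ay|nay] := pselect (trivdom al y).
    by rewrite /psi -(spin_lift_cocycle by_ gy ay) spin_mxM -scalemxAr mulmxA.
  have h0 : (h y)%:C = 0 by rewrite /h (chart_bump_out suppC)// => /CV[].
  have p0 b : psi b y = 0 by apply: etrans (congr1 (fun z => z *: _) h0) (scale0r _).
  by rewrite !p0 mulmx0.
- by apply/matrixP => s z; rewrite (ord1 z) psi_al// !mxE rmorphM rmorph_nat mulrC andbT.
- move=> v; apply/matrixP => s z; rewrite (ord1 z) !mxE andbT.
  have E : cder (fun y => psi al y s 0) x v =
    cder (fun y => ((s == j)%:R * flat 0 (paraboloid r c (coord k y)))%:C) x v.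
    apply: (cder_eq _ oW) => // y [ay ky].
    by rewrite psi_al// /h chart_bump_in.
  rewrite E cder_real.
  have -> : mder (fun y => (s == j)%:R * flat 0 (paraboloid r c (coord k y))) x v =
     'D_v (((s == j)%:R : R) *: (flat 0 \o paraboloid r c)) (coord k x).
    apply: near_eq_derive; have := near_param kx (dom_open k) kx.
    by apply: filterS => u [iu _ _] /=; rewrite (paramK iu).
  have df : differentiable (flat 0 \o paraboloid r c) (coord k x).
    by apply: differentiable_comp => //; exact: flat_differentiable.
  rewrite deriveZ; last exact: diff_derivable.
  rewrite derive_flat_comp//.
  have -> : 'D_v (paraboloid r c) (coord k x) = 2 * d * \sum_i w 0 i * v 0 i.
    have -> := @derive_paraboloid _ _ _ r c id (coord k x) v (did _).
    rewrite mulr_sumr -sumrN; apply: eq_bigr => i _; rewrite derive_id !mxE; ring.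
  rewrite /GRing.scale /= rmorphM rmorph_nat mulrC; congr (_%:C * _); ring.
Unshelve. all: by end_near. Qed.

End TestSections.

(** * Symbols *)

Section CliffordAlgebra.
Variable R : realType.

(** The diagonal entries are m - n i and m + n i, the off-diagonal ones -s + t i and s + t i; sums
    and differences isolate the coefficients. *)
Lemma clifford_basis_free (m n s t : R[i]) :
  m%:M + n *: omega_mx R + s *: gamma_mx R 0 + t *: gamma_mx R 1 = 0 ->
  [/\ m = 0, n = 0, s = 0 & t = 0].
Proof.
have i0 : 'i%C != 0 :> R[i] by rewrite -sqrf_eq0 sqr_i oppr_eq0 oner_eq0.
have n2 : (2 : R[i]) != 0 by rewrite pnatr_eq0.
move=> /matrixP E; have := E 0 0; have := E 0 1; have := E 1 0; have := E 1 1.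
rewrite /omega_mx !mxE !big_ord_recl !big_ord0 /gamma_mx /= !mxE /=.
rewrite ?mulr1n ?mulr0n ?subrr ?subr0 ?sub0r => E11 E10 E01 E00.
have {}E11 : m + n * 'i%C = 0 by rewrite -[RHS]E11; ring.
have {}E10 : s + t * 'i%C = 0 by rewrite -[RHS]E10; ring.
have {}E01 : - s + t * 'i%C = 0 by rewrite -[RHS]E01; ring.
have {}E00 : m - n * 'i%C = 0 by rewrite -[RHS]E00; ring.
have m0 : 2 * m = 0.
  by rewrite (_ : 2 * m = (m + n * 'i%C) + (m - n * 'i%C)); [rewrite E11 E00 addr0|ring].
have n0 : 2 * n * 'i%C = 0.
  by rewrite (_ : _ * 'i%C = (m + n * 'i%C) - (m - n * 'i%C)); [rewrite E11 E00 subr0|ring].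
have s0 : 2 * s = 0.
  by rewrite (_ : 2 * s = (s + t * 'i%C) - (- s + t * 'i%C)); [rewrite E10 E01 subr0|ring].
have t0 : 2 * t * 'i%C = 0.
  by rewrite (_ : _ * 'i%C = (s + t * 'i%C) + (- s + t * 'i%C)); [rewrite E10 E01 addr0|ring].
split; apply/eqP.
- by move/eqP: m0; rewrite mulf_eq0 (negbTE n2).
- by move/eqP: n0; rewrite !mulf_eq0 (negbTE n2) (negbTE i0) orbF.
- by move/eqP: s0; rewrite mulf_eq0 (negbTE n2).
- by move/eqP: t0; rewrite !mulf_eq0 (negbTE n2) (negbTE i0) orbF.
Qed.

Lemma gamma_omega01 : (gamma_mx R 0 *m omega_mx R = - gamma_mx R 1) *
  (gamma_mx R 1 *m omega_mx R = gamma_mx R 0).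
Proof.
split; first by rewrite /omega_mx mulmxA gamma_sq mulNmx mul1mx.
by rewrite gamma_omega /omega_mx -mulmxA gamma_sq mulmxN mulmx1 opprK.
Qed.

Lemma delta_col_eq0 (B : 'M[R[i]]_2) : (forall j, B *m delta_mx j 0 = 0 :> 'cV_2) -> B = 0.
Proof.
move=> H; apply/matrixP => r s; have /matrixP/(_ r 0) := H s.
by rewrite -colE !mxE.
Qed.

End CliffordAlgebra.

Section Symbols.
Variables (R : realType) (M : orientedManifold R 2) (g : M -> 'M[R]_2).
Hypothesis hg : is_metric g.
Variable S : spinStructure g.

(** Orthonormality of [E] gives g^-1 = E^T E, so the gradient has the coefficients df(e_k) in the
    frame. There [J] acts by the constant matrix [rot], and coefficients can be compared because [E]
    is invertible. *)
Lemma cgrad_rotation (J : M -> 'M[R]_2) (p q : M -> R[i]) (x : M) (E : 'M[R]_2) :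
  is_rotation g J -> oriented_orthonormal g x E -> cdiff p x -> cdiff q x ->
  cgrad g p x = cJ J x (cgrad g q x) <->
  cder p x (row 0 E) = - cder q x (row 1 E) /\ cder p x (row 1 E) = cder q x (row 0 E).
Proof.
move=> hJ oE dp dq; have [EgE _] := oE; have [J0 J1] := hJ x E oE.
pose C (B : 'M[R]_2) := map_mx (real_complex R) B.
have gE : invmx (g x) = E^T *m E.
  have gEE : g x *m (E^T *m E) = 1%:M.
    by rewrite mulmxA; apply: mulmx1C; rewrite mulmxA.
  by rewrite -[LHS]mulmx1 -gEE mulKmx// (metric_unit hg).
have uE : C E \in unitmx.
  by rewrite map_unitmx; have [] := mulmx1_unit (etrans (mulmxA _ _ _) EgE).
pose rot : 'M[R]_2 := \matrix_(i, j) (if i == j then 0 else if i == 0 then 1 else -1).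
have EJ : E *m J x = rot *m E.
  apply/row_matrixP => i; rewrite !row_mul.
  have [->|->] := ord2P i; [rewrite J0|rewrite J1]; apply/rowP => j;
    by rewrite !mxE sum_ord2 !mxE /= ?mul0r ?mul1r ?mulN1r ?add0r ?addr0.
have grad f : cdiff f x -> cgrad g f x = (\row_k cder f x (row k E)) *m C E.
  move=> df; rewrite /cgrad gE map_mxM mulmxA; congr (_ *m _).
  apply/rowP => k; rewrite !mxE (cder_basis _ df); apply: eq_bigr => j _.
  by rewrite !mxE mulrC.
rewrite !grad// /cJ -mulmxA -map_mxM EJ map_mxM mulmxA.
split=> [/(can_inj (mulmxK uE)) /rowP G|[G0 G1]].
  have := G 0; have := G 1; rewrite !mxE !sum_ord2 !mxE /= !rmorph0 rmorph1 rmorphN1.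
  by rewrite !mulr0 mulr1 mulrN1 add0r addr0 => -> ->.
congr (_ *m _); apply/rowP => j; rewrite !mxE sum_ord2 !mxE.
have [->|->] := ord2P j; rewrite ?G0 ?G1 /= !rmorph0 ?rmorph1 ?rmorphN1.
- by rewrite mulr0 mulrN1 add0r.
- by rewrite mulr0 mulr1 addr0.
Qed.

Lemma factor_symbol Om (psi : spinor S) al x (c : R) (eta : R[i]) (A : M -> 'M[R]_2)
    (a b p q : M -> R[i]) (E := frame al x) :
  open Om -> is_section Om psi -> Om x -> trivdom al x -> csmooth Om p -> csmooth Om q ->
  (dirac_factor a b \o dirac_factor p q) psi al x - B_op c eta A psi al x =
  ((a x + p x)%:M + (b x - q x - 2 * eta) *: omega_mx R) *m dirac psi al x +
  ((a x * p x - b x * q x - (shape_norm2 A x - mean_curvature A x ^+ 2 - 2 * c)%:C)%:M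
   + (a x * q x + b x * p x + 2 * eta * (mean_curvature A x)%:C) *: omega_mx R
   + (cder p x (row 0 E) + cder q x (row 1 E)) *: gamma_mx R 0
   + (cder p x (row 1 E) - cder q x (row 0 E)) *: gamma_mx R 1) *m psi al x.
Proof.
move=> oO sec Ox ax sp sq; rewrite (factor_product hg c eta A a b oO sec Ox ax sp sq).
rewrite !sum_ord2 !(mulmxA _ (omega_mx R)) !gamma_omega01.
rewrite -/E; move: (dirac psi al x) (psi al x) => D P.
rewrite !mulmxDl !mul_scalar_mx -!scalemxAl mulNmx.
move: (omega_mx R *m D) (omega_mx R *m P) (gamma_mx R 0 *m P) (gamma_mx R 1 *m P).
move=> WD W G0 G1.
move: (cder p x _) (cder p x _) (cder q x _) (cder q x _) => p0 p1 q0 q1.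
move: (a x + p x) (b x - q x - 2 * eta) (a x * p x - _ - _) (a x * q x + _ + _).
by move=> k1 k2 k3 k4; apply/matrixP => r z; rewrite !mxE; clear; ring.
Qed.

(** At a fixed point the identity is linear in the value and the first derivative of the section;
    test sections let these vary independently enough to annihilate the matrices [L] and [N0]. *)
Lemma factorization_symbol Om (c : R) (eta : R[i]) (A : M -> 'M[R]_2) (a b p q : M -> R[i])
    (al : trivn S) x (E := frame al x) :
  open Om -> csmooth Om p -> csmooth Om q -> Om x -> trivdom al x ->
  eq_on_sections (S := S) Om (B_op c eta A) (dirac_factor a b \o dirac_factor p q) ->
  [/\ a x + p x = 0, b x - q x - 2 * eta = 0,
   a x * p x - b x * q x - (shape_norm2 A x - mean_curvature A x ^+ 2 - 2 * c)%:C = 0 &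
   [/\ a x * q x + b x * p x + 2 * eta * (mean_curvature A x)%:C = 0,
   cder p x (row 0 E) + cder q x (row 1 E) = 0 &
   cder p x (row 1 E) - cder q x (row 0 E) = 0]].
Proof.
move=> oO sp sq Ox ax H.
pose L := (a x + p x)%:M + (b x - q x - 2 * eta) *: omega_mx R.
set m := a x * p x - _ - _; set n := _ + _ + 2 * eta * _.
set s := cder p x (row 0 E) + _; set t := cder p x (row 1 E) - _.
pose N0 := m%:M + n *: omega_mx R + s *: gamma_mx R 0 + t *: gamma_mx R 1.
have eqn psi : is_section Om psi -> L *m dirac psi al x + N0 *m psi al x = 0.
  move=> sec; rewrite -(factor_symbol c eta A a b oO sec Ox ax sp sq).
  by rewrite (H psi sec al x Ox ax) subrr.
(* The zeroth-order part of the Dirac operator at [x]: D psi is [conn] applied to psi plus the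
   Clifford-contracted derivative of its components. *)
pose conn := \sum_k gamma_mx R k *m ((connection al k x / 2)%:C *: omega_mx R).
have test (w : 'rV[R]_2) (j : 'I_2) : exists (t kap : R), [/\ 0 < t, 0 < kap &
    (L *m conn + N0) *m (t%:C *: delta_mx j 0) + (kap%:C *: (L *m
     (\sum_k ((w *m E^T) 0 k)%:C *: gamma_mx R k))) *m delta_mx j 0 = 0 :> 'cV_2].
  have [psi [t' [kap [t0 k0 sec P dP]]]] := test_section j w oO Ox ax.
  have DE : dirac psi al x = conn *m psi al x +
      (kap%:C *: \sum_k ((w *m E^T) 0 k)%:C *: gamma_mx R k) *m delta_mx j 0.
    rewrite dirac_mx /conn -scalemxAl !mulmx_suml scaler_sumr -big_split.
    apply: eq_bigr => k _ /=.
    have -> : (w *m E^T) 0 k = \sum_i w 0 i * row k E 0 i.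
      by rewrite mxE; apply: eq_bigr => i _; rewrite !mxE.
    rewrite dP mulmxDr [RHS]addrC; congr (_ + _); last by rewrite -mulmxA scalemxAl.
    by rewrite rmorphM -scalemxAl -scalemxAr scalerA.
  exists t', kap; split=> //; have := eqn psi sec; rewrite DE P => <-.
  clearbody L N0 conn; rewrite (mulmxDr L) (mulmxDl (L *m conn) N0) (addrAC _ (N0 *m _)).
  by rewrite -!scalemxAl -!scalemxAr !mulmxA.
(* Taking w = 0 removes the derivative and leaves a condition on the value alone. *)
have N1 : L *m conn + N0 = 0.
  apply: delta_col_eq0 => j; have [t' [kap [t0 _]]] := test 0 j.
  rewrite mul0mx (eq_bigr (fun=> 0)); last by move=> k _; rewrite mxE scale0r.
  rewrite big1// mulmx0 scaler0 mul0mx addr0 -scalemxAr => /eqP.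
  by rewrite scaler_eq0 fmorph_eq0 gt_eqF//= => /eqP.
have [_ detE] := @frame_on _ _ _ S al x ax.
have uE : E^T \in unitmx by rewrite unitmx_tr unitmxE unitfE gt_eqF.
(* The value term is now gone. This [w] makes the derivative of the test section vanish along the
   second frame vector and not along the first, so only the generator [gamma_mx R 0] survives; it
   squares to -1, hence L = 0. *)
have L0 : L *m gamma_mx R 0 = 0.
  apply: delta_col_eq0 => j.
  have [t' [kap [_ k0]]] := test ('e_0 *m invmx E^T) j.
  rewrite N1 mul0mx add0r mulmxKV// !big_ord_recl big_ord0 addr0 !mxE /=.
  rewrite scale0r addr0 scale1r -scalemxAl => /eqP.
  by rewrite scaler_eq0 fmorph_eq0 gt_eqF//= => /eqP.
have {}L0 : L = 0.
  by rewrite -[L]mulmx1 -[1%:M]opprK -(gamma_sq R 0) mulmxN mulmxA L0 mul0mx oppr0.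
have [|-> -> _ _] := @clifford_basis_free R (a x + p x) (b x - q x - 2 * eta) 0 0.
  by rewrite !scale0r !addr0.
have [|-> -> -> ->] := @clifford_basis_free R m n s t; last by [].
by rewrite -[LHS]/N0 -N1 L0 mul0mx add0r.
Qed.

End Symbols.

Theorem theorem7p2 (R : realType) (c : R)
    (N : orientedManifold R 3) (gN : N -> 'M[R]_3)
    (hN : is_space_form gN c)
    (M : orientedManifold R 2) (g : M -> 'M[R]_2) (hg : is_metric g)
    (phi : M -> N) (hphi : isometric_immersion g gN phi)
    (xi : M -> 'rV[R]_3) (hxi : unit_normal gN phi xi)
    (A : M -> 'M[R]_2) (hA : shape_operator gN phi xi A)
    (J : M -> 'M[R]_2) (hJ : is_rotation g J)
    (S : spinStructure g)
    (eta : R[i]) (heta : 4 * eta ^+ 2 = c%:C)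
    (Om : set M) (hOm : open Om)
    (a b p q : M -> R[i])
    (ha : csmooth Om a) (hb : csmooth Om b)
    (hp : csmooth Om p) (hq : csmooth Om q) :
  (eq_on_sections (S := S) Om (B_op c eta A)
     (dirac_factor a b \o dirac_factor p q) <->
   forall x, Om x ->
     [/\ a x = - p x,
         b x = q x + 2 * eta,
         cgrad g p x = cJ J x (cgrad g q x),
         2 * eta * (p x + (mean_curvature A x)%:C) = 0 &
         p x ^+ 2 + q x * (q x + 2 * eta) =
         (mean_curvature A x ^+ 2 + 2 * c - shape_norm2 A x)%:C]) /\
  (c != 0 ->
   eq_on_sections (S := S) Om (B_op c eta A)
     (dirac_factor a b \o dirac_factor p q) ->
   forall x, Om x -> p x = - (mean_curvature A x)%:C).
Proof.
have fwd : eq_on_sections (S := S) Om (B_op c eta A)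
     (dirac_factor a b \o dirac_factor p q) ->
   forall x, Om x ->
     [/\ a x = - p x,
         b x = q x + 2 * eta,
         cgrad g p x = cJ J x (cgrad g q x),
         2 * eta * (p x + (mean_curvature A x)%:C) = 0 &
         p x ^+ 2 + q x * (q x + 2 * eta) =
         (mean_curvature A x ^+ 2 + 2 * c - shape_norm2 A x)%:C].
  move=> H x Ox; have [al ax] := @trivdom_cover _ _ _ S x.
  have [E1 E2 E3 [E4 E5 E6]] := factorization_symbol hg hOm hp hq Ox ax H.
  have aE : a x = - p x by apply/eqP; rewrite -addr_eq0 E1.
  have bE : b x = q x + 2 * eta.
    by apply/eqP; rewrite -subr_eq0 opprD addrA E2.
  split => //.
  - apply/(cgrad_rotation hg hJ (@frame_on _ _ _ S al x ax)).
    + exact: csmooth_cdiff hp Ox.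
    + exact: csmooth_cdiff hq Ox.
    + by split; apply/eqP; [rewrite -addr_eq0 E5|rewrite -subr_eq0 E6].
  (* After substitution the terms -p q and q p cancel in a q + b p, leaving 2 eta p. *)
  - by rewrite -E4 aE bE; clear; ring.
  - apply/eqP; rewrite -subr_eq0 -oppr_eq0 -E3 aE bE !rmorphB !rmorphD /=.
    by apply/eqP; clear; ring.
split; last first.
  (* Since 4 eta^2 = c, a nonzero [c] makes [eta] nonzero, and the fourth equation can be divided by
     2 eta. *)
  move=> c0 H x Ox; have [_ _ _ /eqP + _] := fwd H x Ox.
  have eta0 : eta != 0.
    apply: contraNneq c0 => eta0; move: heta; rewrite eta0 expr0n mulr0 => /esym/eqP.
    by rewrite fmorph_eq0.
  by rewrite !mulf_eq0 pnatr_eq0 (negbTE eta0) /= addr_eq0 => /eqP.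
split=> // H psi sec al x Ox ax.
have [aE bE /(cgrad_rotation hg hJ (@frame_on _ _ _ S al x ax)) G E4 E5] := H x Ox.
have [//|//|G0 G1] := G.
- exact: csmooth_cdiff hp Ox.
- exact: csmooth_cdiff hq Ox.
apply/esym/eqP; rewrite -subr_eq0 (factor_symbol hg c eta A a b hOm sec Ox ax hp hq).
rewrite G0 G1 addNr subrr !scale0r !addr0.
have -> : a x + p x = 0 by rewrite aE addNr.
have -> : b x - q x - 2 * eta = 0 by rewrite bE; clear; ring.
have -> : a x * q x + b x * p x + 2 * eta * (mean_curvature A x)%:C = 0.
  by rewrite -E4 aE bE; clear; ring.
have -> : a x * p x - b x * q x
    - (shape_norm2 A x - mean_curvature A x ^+ 2 - 2 * c)%:C = 0.
  apply/eqP; rewrite -oppr_eq0 -(subrr (p x ^+ 2 + q x * (q x + 2 * eta))) {2}E5.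
  by rewrite aE bE !rmorphB !rmorphD /=; apply/eqP; clear; ring.
by rewrite !raddf0 scale0r addr0 !mul0mx addr0.
Qed.
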